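(* Assume: (A1) $\sup_{i,j}\|X_{ij}\|=O(\sqrt{p_n})$; (A2) the unknown parameter $\beta_n$ belongs to a compact subset $\mathcal{B}\subseteq\mathbb{R}^{p_n}$, the true value $\beta_{n0}$ lies in the interior of $\mathcal{B}$, and there are constants $b_1,b_2$ (not depending on $n$) with $0<b_1\le\pi_{ij}(\beta_{n0})\le b_2<1$ for all $i,j$; (A3) there are positive constants $b_3,b_4$ with $b_3\le\lambda_{\min}\big(n^{-1}\sum_{i=1}^nX_i^TX_i\big)\le\lambda_{\max}\big(n^{-1}\sum_{i=1}^nX_i^TX_i\big)\le b_4$; (A4) the common true correlation matrix $R_0$ has eigenvalues bounded away from $0$ and $+\infty$, and the estimated working correlation matrix $\widehat R$ satisfies $\|\widehat R^{-1}-\overline R^{-1}\|=O_p(\sqrt{p_n/n})$, where $\overline R$ is a constant positive definite matrix with eigenvalues bounded away from $0$ and $+\infty$ ($\overline R$ is not required to equal $R_0$). Suppose also $n^{-1}p_n^2=o(1)$. Then the equation $S_n(\beta_n)=0$ has a root $\widehat\beta_n$ such that $$\|\widehat\beta_n-\beta_{n0}\|=O_p\big(\sqrt{p_n/n}\big);$$ that is, for every $\epsilon>0$ there is $\Delta>0$ such that for all sufficiently large $n$, with probability at least $1-\epsilon$, the equation $S_n(\beta_n)=0$ has a root $\widehat\beta_n$ with $\|\widehat\beta_n-\beta_{n0}\|\le\Delta\sqrt{p_n/n}$.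
   Context: Setting: the number of clusters $n\to\infty$, the cluster size $m<\infty$ is a fixed integer, and the number of covariates $p_n\to\infty$ as $n\to\infty$. For each $n$, each cluster $i=1,\dots,n$ and each $j=1,\dots,m$, one observes a binary response $Y_{ij}\in\{0,1\}$ and a covariate vector $X_{ij}\in\mathbb{R}^{p_n}$ (covariates are treated as fixed: all moments and probabilities are conditional on them; dependence on $n$ is suppressed). $Y_i=(Y_{i1},\dots,Y_{im})^T$, and $X_i=(X_{i1},\dots,X_{im})^T$ is the $m\times p_n$ matrix with rows $X_{ij}^T$. $Y_1,\dots,Y_n$ are independent; components of one $Y_i$ may be dependent. For $\beta\in\mathbb{R}^{p_n}$ let $\pi_{ij}(\beta)=\exp(X_{ij}^T\beta)/[1+\exp(X_{ij}^T\beta)]$ and $\pi_i(\beta)=(\pi_{i1}(\beta),\dots,\pi_{im}(\beta))^T$. The true parameter $\beta_{n0}$ satisfies $E(Y_{ij})=\pi_{ij}(\beta_{n0})$, hence $\mathrm{Var}(Y_{ij})=\pi_{ij}(\beta_{n0})(1-\pi_{ij}(\beta_{n0}))$. All $Y_i$ have the same $m\times m$ true correlation matrix $R_0$. $A_i(\beta)$ is the $m\times m$ diagonal matrix with $j$th diagonal entry $A_{ij}(\beta)=\pi_{ij}(\beta)(1-\pi_{ij}(\beta))$. $\widehat R$ is an estimated $m\times m$ working correlation matrix (random, and not depending on the argument $\beta_n$ of the estimating function). The generalized estimating function is $$S_n(\beta_n)=\sum_{i=1}^nX_i^TA_i^{1/2}(\beta_n)\widehat R^{-1}A_i^{-1/2}(\beta_n)\big(Y_i-\pi_i(\beta_n)\big).$$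 $\|\cdot\|$ is the Euclidean norm for vectors and the Frobenius norm for matrices; $\lambda_{\min},\lambda_{\max}$ denote smallest and largest eigenvalues. *)

(* Defs.v *)
From HB Require Import structures.
From mathcomp Require Import all_boot all_order all_algebra.
From mathcomp Require Import all_classical all_reals all_analysis.
Set Implicit Arguments.
Unset Strict Implicit.
Unset Printing Implicit Defensive.
Import Order.TTheory GRing.Theory Num.Theory.
Import numFieldNormedType.Exports.
Local Open Scope classical_set_scope.
Local Open Scope ring_scope.

(* The library norm `|A| on matrices is the sup norm; the norm below is the
   Frobenius norm, which for row and column vectors is the Euclidean norm. *)
Definition frobnorm (R : realType) (q r : nat) (A : 'M[R]_(q, r)) : R :=
  Num.sqrt (\sum_(i < q) \sum_(j < r) A i j ^+ 2).

(* Only applied to symmetric matrices, all of whose eigenvalues are real; for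
   q > 0 the set of eigenvalues is then finite and nonempty. *)
Definition lambda_min (R : realType) (q : nat) (A : 'M[R]_q) : R :=
  inf [set a | eigenvalue A a].
Definition lambda_max (R : realType) (q : nat) (A : 'M[R]_q) : R :=
  sup [set a | eigenvalue A a].

Definition posdefmx (R : realType) (q : nat) (A : 'M[R]_q) : Prop :=
  A^T = A /\ forall u : 'cV[R]_q, u != 0 -> 0 < (u^T *m A *m u) 0 0.

(* Inner probability: A itself need not be measurable. *)
Definition prob_ge d (T : measurableType d) (R : realType)
    (P : probability T R) (c : R) (A : set T) : Prop :=
  exists E : set T, [/\ measurable E, E `<=` A & (c%:E <= P E)%E].

(* Z n = O_p(r n), where Z n is a random variable on its own space (T n, P n) *)
Definition bigO_prob (d : nat -> measure_display)
    (T : forall n, measurableType (d n)) (R : realType)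
    (P : forall n, probability (T n) R)
    (Z : forall n, T n -> R) (r : nat -> R) : Prop :=
  forall eps : R, 0 < eps -> exists2 M : R, 0 < M &
    \forall n \near \oo,
      prob_ge (P n) (1 - eps) [set w | `|Z n w| <= M * r n].

Definition correlation d (T : measurableType d) (R : realType)
    (P : probability T R) (X Y : T -> R) : R :=
  fine (covariance P X Y) /
  (Num.sqrt (fine 'V_P[X]) * Num.sqrt (fine 'V_P[Y])).

Definition sigma_of d (T : measurableType d) (R : realType) (m : nat)
    (Z : 'I_m -> T -> R) : set (set T) :=
  <<s [set A | exists j, exists2 B : set R, measurable B & A = Z j @^-1` B] >>.

Definition indep_vectors d (T : measurableType d) (R : realType)
    (P : probability T R) (n m : nat) (Y : 'I_n -> 'I_m -> T -> R) : Prop :=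
  forall (J : {set 'I_n}) (E : 'I_n -> set T),
    (forall i, i \in J -> sigma_of (Y i) (E i)) ->
    P (\bigcap_(i in [set` J]) E i) = (\prod_(i in J) P (E i))%E.

Section EstimatingFunction.
Variables (R : realType) (m p : nat).
Implicit Types (Xi : 'M[R]_(m, p)) (b : 'cV[R]_p).

Definition logit_mean Xi b : 'cV[R]_m :=
  \col_j (expR ((Xi *m b) j 0) / (1 + expR ((Xi *m b) j 0))).

Definition logit_var Xi b (j : 'I_m) : R :=
  logit_mean Xi b j 0 * (1 - logit_mean Xi b j 0).

Definition half_A Xi b : 'M[R]_m :=
  diag_mx (\row_j Num.sqrt (logit_var Xi b j)).

Definition neg_half_A Xi b : 'M[R]_m :=
  diag_mx (\row_j (Num.sqrt (logit_var Xi b j))^-1).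

(* W is the working correlation matrix. *)
Definition estfun (n : nat) (X : 'I_n -> 'M[R]_(m, p)) (Y : 'I_n -> 'cV[R]_m)
    (W : 'M[R]_m) b : 'cV[R]_p :=
  \sum_(i < n) (X i)^T *m half_A (X i) b *m invmx W *m neg_half_A (X i) b
                *m (Y i - logit_mean (X i) b).

Definition gram (n : nat) (X : 'I_n -> 'M[R]_(m, p)) : 'M[R]_p :=
  n%:R^-1 *: \sum_(i < n) (X i)^T *m X i.

End EstimatingFunction.

(* Main.v *)
Require Import Defs.
From HB Require Import structures.
From mathcomp Require Import all_boot all_order all_algebra.
From mathcomp Require Import all_classical all_reals all_analysis.
From mathcomp Require Import measurable_realfun ring lra.

(** Why the theorem is true.  On the ball of radius Delta sqrt(p/n) around the
    truth the estimating function S_n is almost affine, with a slope -H whose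
    coercivity is of order n, while S_n at the truth is only O_p(sqrt(n p)).
    The quasi-Newton map b + H^-1 S_n(b) is then a contraction of that ball, and
    its fixed point is the root ([quasi_newton_root]).

    The logistic link makes the analysis explicit.  With sd = sqrt(pi (1 - pi))
    as a function of the linear predictor, a summand of S_n is
      Q_jk x_ij sd(theta_ij) pearson(y_ik, theta_ik),    Q = Rhat^-1,
    where pearson(y, t) = (y - pi(t)) / sd(t) = y e^(-t/2) - (1 - y) e^(t/2).
    So each summand is a product of two smooth functions of one variable.  The
    covariate vectors have norm O(sqrt p), so moving the parameter inside the
    ball moves every linear predictor by at most a multiple of
    p / sqrt n = o(1), and the expansion of [summand_linearization] holds
    uniformly in the clusters.

    Summing up, [estfun_increment] writes S_n(b) - S_n(c) + H (b - c), where
    H = sum_i X_i^T A_i^(1/2) Rbar^-1 A_i^(1/2) X_i at the truth, as four terms: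
    the remainder of the expansion; two forms given by p x p matrices which are
    sums of independent centred terms, with Frobenius norm O_p(p sqrt n); and
    the error made by replacing Rhat^-1 by Rbar^-1.  The upper bound on the Gram
    matrix and p^2/n = o(1) make all four o(n) |b - c| ([estfun_increment_le]),
    and the lower bound makes H coercive ([limit_jacobian_coercive]).

    Probability enters only through second moments.  The entries of Rhat^-1 are
    bounded factors in front of sums over clusters that do not involve Rhat, so
    the dependence between Rhat and the responses is harmless, and those sums
    are controlled by uncorrelatedness and Markov's inequality
    ([weighted_sums_prob_ge]).  [root_prob_ge] collects this for one sample size
    with explicit constants; the theorem chooses Delta from those constants and
    lets n grow until p / sqrt n is below the threshold that they require. *)

Import Order.TTheory GRing.Theory Num.Theory.
Import numFieldNormedType.Exports.
Local Open Scope classical_set_scope.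
Local Open Scope ring_scope.

Set Implicit Arguments.
Unset Strict Implicit.
Unset Printing Implicit Defensive.

(** * Frobenius inner product and norm *)

Lemma sqr_sum_mul_le (R : realFieldType) (I : finType) (a b : I -> R) :
  (\sum_i a i * b i) ^+ 2 <= (\sum_i a i ^+ 2) * (\sum_i b i ^+ 2).
Proof.
pose S := \sum_i a i ^+ 2; pose Q := \sum_i b i ^+ 2; pose C := \sum_i a i * b i.
have S0 : 0 <= S by apply: sumr_ge0 => i _; exact: sqr_ge0.
(* The discriminant of this polynomial in t is what has to be nonpositive. *)
have H t : 0 <= t ^+ 2 * S - t *+ 2 * C + Q.
  have -> : t ^+ 2 * S - t *+ 2 * C + Q = \sum_i (t * a i - b i) ^+ 2.
    rewrite !mulr_sumr -sumrB -big_split /=.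
    by apply: eq_bigr => i _; ring.
  by apply: sumr_ge0 => i _; exact: sqr_ge0.
rewrite -/S -/Q -/C; case: (ltgtP 0 S) S0 => // [S_gt0 _|S0 _].
  have := H (C / S); set x := C / S => Hx.
  have CE : C = x * S by rewrite /x divfK // gt_eqF.
  move: Hx; rewrite CE => Hx.
  have : 0 <= S * (x ^+ 2 * S - x *+ 2 * (x * S) + Q) by rewrite mulr_ge0 // ltW.
  by rewrite (_ : S * _ = S * Q - (x * S) ^+ 2) ?subr_ge0 //; ring.
have a0 i : a i = 0.
  have /eqP := @psumr_eq0P _ _ predT _ (fun i _ => sqr_ge0 (a i)) (esym S0) i isT.
  by rewrite sqrf_eq0 => /eqP.
have -> : C = 0 by rewrite /C big1 // => i _; rewrite a0 mul0r.
have Q0 : 0 <= Q by apply: sumr_ge0 => i _; exact: sqr_ge0.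
by rewrite -S0 mul0r expr0n.
Qed.

Section Frobenius.
Context {R : realType}.

Definition frobdot q r (A B : 'M[R]_(q, r)) : R :=
  \sum_i \sum_j A i j * B i j.

Lemma frobnorm_ge0 q r (A : 'M[R]_(q, r)) : 0 <= frobnorm A.
Proof. exact: sqrtr_ge0. Qed.

Lemma sqr_frobnorm q r (A : 'M[R]_(q, r)) :
  frobnorm A ^+ 2 = \sum_i \sum_j A i j ^+ 2.
Proof.
by rewrite sqr_sqrtr // sumr_ge0 // => i _; apply: sumr_ge0 => j _; exact: sqr_ge0.
Qed.

Lemma frobdotxx q r (A : 'M[R]_(q, r)) : frobdot A A = frobnorm A ^+ 2.
Proof. by rewrite sqr_frobnorm; do 2!apply: eq_bigr => ? _; rewrite expr2. Qed.

Lemma frobdot_le q r (A B : 'M[R]_(q, r)) :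
  `|frobdot A B| <= frobnorm A * frobnorm B.
Proof.
rewrite -ler_sqr ?nnegrE ?mulr_ge0 ?frobnorm_ge0 // exprMn !sqr_frobnorm.
rewrite real_normK ?num_real // /frobdot !pair_bigA /=.
exact: sqr_sum_mul_le.
Qed.

Lemma frobdotDl q r (A B C : 'M[R]_(q, r)) :
  frobdot (A + B) C = frobdot A C + frobdot B C.
Proof.
rewrite -big_split; apply: eq_bigr => i _; rewrite -big_split.
by apply: eq_bigr => j _; rewrite mxE mulrDl.
Qed.

Lemma frobdotC q r (A B : 'M[R]_(q, r)) : frobdot A B = frobdot B A.
Proof. by do 2!apply: eq_bigr => ? _; rewrite mulrC. Qed.

Lemma frobdotDr q r (A B C : 'M[R]_(q, r)) :
  frobdot C (A + B) = frobdot C A + frobdot C B.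
Proof. by rewrite !(frobdotC C) frobdotDl. Qed.

Lemma frobdotZl q r k (A B : 'M[R]_(q, r)) :
  frobdot (k *: A) B = k * frobdot A B.
Proof.
rewrite /frobdot mulr_sumr; apply: eq_bigr => i _; rewrite mulr_sumr.
by apply: eq_bigr => j _; rewrite mxE mulrA.
Qed.

Lemma frobdotZr q r k (A B : 'M[R]_(q, r)) :
  frobdot A (k *: B) = k * frobdot A B.
Proof. by rewrite frobdotC frobdotZl frobdotC. Qed.

Lemma frobdotNl q r (A B : 'M[R]_(q, r)) : frobdot (- A) B = - frobdot A B.
Proof. by rewrite -scaleN1r frobdotZl mulN1r. Qed.

Lemma frobdotBl q r (A B C : 'M[R]_(q, r)) :
  frobdot (A - B) C = frobdot A C - frobdot B C.
Proof. by rewrite frobdotDl frobdotNl. Qed.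

Lemma frobdotBr q r (A B C : 'M[R]_(q, r)) :
  frobdot C (A - B) = frobdot C A - frobdot C B.
Proof. by rewrite !(frobdotC C) frobdotBl. Qed.

Lemma frobdot_suml q r (I : finType) (F : I -> 'M[R]_(q, r)) (B : 'M[R]_(q, r)) :
  frobdot (\sum_i F i) B = \sum_i frobdot (F i) B.
Proof.
apply: (big_ind2 (fun (x : 'M[R]_(q, r)) y => frobdot x B = y)) => //.
- by rewrite /frobdot big1 // => i _; rewrite big1 // => j _; rewrite mxE mul0r.
- by move=> x1 x2 y1 y2 <- <-; rewrite frobdotDl.
Qed.

Lemma trmx_mul_frobdot q (u v : 'cV[R]_q) : (u^T *m v) 0 0 = frobdot u v.
Proof.
by rewrite mxE /frobdot; apply: eq_bigr => i _; rewrite big_ord1 !mxE.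
Qed.

Lemma frobnormZ q r k (A : 'M[R]_(q, r)) : frobnorm (k *: A) = `|k| * frobnorm A.
Proof.
rewrite /frobnorm -sqrtr_sqr -sqrtrM ?sqr_ge0 //; congr Num.sqrt.
rewrite mulr_sumr; apply: eq_bigr => i _; rewrite mulr_sumr.
by apply: eq_bigr => j _; rewrite mxE exprMn.
Qed.

Lemma frobnormN q r (A : 'M[R]_(q, r)) : frobnorm (- A) = frobnorm A.
Proof. by rewrite -scaleN1r frobnormZ normrN normr1 mul1r. Qed.

Lemma frobnormB q r (A B : 'M[R]_(q, r)) : frobnorm (A - B) = frobnorm (B - A).
Proof. by rewrite -frobnormN opprB. Qed.

Lemma frobnorm0 q r : frobnorm (0 : 'M[R]_(q, r)) = 0.
Proof. by rewrite -(scale0r (0 : 'M[R]_(q, r))) frobnormZ normr0 mul0r. Qed.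

Lemma ler_frobnormD q r (A B : 'M[R]_(q, r)) :
  frobnorm (A + B) <= frobnorm A + frobnorm B.
Proof.
rewrite -ler_sqr ?nnegrE ?addr_ge0 ?frobnorm_ge0 // -frobdotxx.
rewrite frobdotDl !frobdotDr !frobdotxx (frobdotC B A).
have := ler_norm (frobdot A B); have := frobdot_le A B; nra.
Qed.

Lemma ler_frobdist q r (A B : 'M[R]_(q, r)) :
  `|frobnorm A - frobnorm B| <= frobnorm (A - B).
Proof.
have h (C D : 'M[R]_(q, r)) : frobnorm C - frobnorm D <= frobnorm (C - D).
  by rewrite lerBlDr -[in leLHS](subrK D C) ler_frobnormD.
by rewrite ler_norml h andbT lerNl opprB frobnormB h.
Qed.

Lemma entry_le_frobnorm q r (A : 'M[R]_(q, r)) i j : `|A i j| <= frobnorm A.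
Proof.
rewrite -ler_sqr ?nnegrE ?frobnorm_ge0 // sqr_frobnorm real_normK ?num_real //.
rewrite pair_bigA /= (bigD1 (i, j)) //= lerDl.
by apply: sumr_ge0 => k _; exact: sqr_ge0.
Qed.

Lemma frobnorm_eq0 q r (A : 'M[R]_(q, r)) : (frobnorm A == 0) = (A == 0).
Proof.
apply/eqP/eqP => [A0|->]; last exact: frobnorm0.
apply/matrixP => i j; apply/eqP; rewrite mxE -normr_le0 -A0.
exact: entry_le_frobnorm.
Qed.

Lemma frobnorm_le_mxnorm q r (A : 'M[R]_(q, r)) :
  frobnorm A <= (q%:R * r%:R + 1) * `|A|.
Proof.
have qr0 : 0 <= q%:R * r%:R :> R by rewrite mulr_ge0.
have qr1 : 0 <= (q%:R * r%:R + 1) * `|A| by rewrite mulr_ge0 // addr_ge0.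
rewrite -ler_sqr ?nnegrE ?frobnorm_ge0 //.
rewrite sqr_frobnorm pair_bigA /=.
apply: (@le_trans _ _ (\sum_(i : 'I_q * 'I_r) `|A| ^+ 2)).
  apply: ler_sum => -[i j] _ /=; rewrite -(real_normK (num_real _)).
  rewrite ler_sqr ?nnegrE //.
  rewrite [leRHS]/Num.norm /= mx_normrE.
  exact: (le_bigmax _ (fun k : 'I_q * 'I_r => `|A k.1 k.2|) (i, j)).
rewrite sumr_const card_prod !card_ord exprMn -[leLHS]mulr_natl natrM.
rewrite ler_wpM2r ?sqr_ge0 //; nra.
Qed.

(** Compactness holds for the topology of the sup norm.  On vectors of a fixed
    length the two norms are equivalent, so Lipschitz bounds in Frobenius norm
    make [f] continuous and the sublevel set of [g] closed. *)
Lemma frob_attains_min q (g f : 'cV[R]_q -> R) (L M : R) u0 :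
  g u0 <= 0 ->
  (forall u, g u <= 0 -> frobnorm u <= M) ->
  (forall u v, `|g u - g v| <= frobnorm (u - v)) ->
  (forall u v, g u <= 0 -> g v <= 0 -> `|f u - f v| <= L * frobnorm (u - v)) ->
  exists2 u, g u <= 0 & forall v, g v <= 0 -> f u <= f v.
Proof.
move=> gu0 gM glip flip.
pose c : R := 1%:R * q%:R + 1.
have c0 : 0 < c by rewrite /c; have := ler0n R q; nra.
have cle (u v : 'rV[R]_q) : frobnorm (u^T - v^T) <= c * `|u - v|.
  apply: le_trans (frobnorm_le_mxnorm (u - v)).
  by rewrite -linearB /frobnorm exchange_big /= le_eqVlt; apply/orP; left;
     apply/eqP; congr Num.sqrt; do 2!apply: eq_bigr => ? _; rewrite !mxE.
have near_dist (u : 'rV[R]_q) e : 0 < e -> \forall v \near u, `|u - v| < e.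
  by move=> e0; have := nbhsx_ballx u e e0; rewrite -ball_normE.
pose A : set 'rV[R]_q := [set u | g u^T <= 0].
have gcont : continuous (fun u : 'rV[R]_q => g u^T).
  move=> u; apply/(@cvgrPdist_lt _ _ _ (nbhs u)) => e e0; near=> v.
  apply: le_lt_trans (glip _ _) _; apply: le_lt_trans (cle _ _) _.
  rewrite mulrC -ltr_pdivlMr //; near: v.
  by apply: near_dist; rewrite divr_gt0.
have Acl : closed A by apply: (closed_comp (fun u _ => gcont u)) (@closed_le _ 0).
have Ab : bounded_set A.
  exists M; split; first exact: num_real.
  move=> x Mx u Au; apply: le_trans (ltW Mx).
  rewrite [leLHS]/Num.norm /= mx_normrE; apply: bigmax_le => /= [|[i j] _].
    by apply: le_trans (gM _ Au); exact: frobnorm_ge0.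
  apply: le_trans (gM _ Au); have <- : u^T j i = u i j by rewrite mxE.
  exact: entry_le_frobnorm.
have := @compact_EVT_min _ _ (fun u : 'rV[R]_q => f u^T) A.
case.
- by exists u0^T; rewrite /A /= trmxK.
- exact: bounded_closed_compact.
- apply/subspace_continuousP => u Au; apply/(@cvgrPdist_lt _ _ _ (within A (nbhs u))) => e e0.
  have L1 : 0 < `|L| + 1 by have := normr_ge0 L; lra.
  near=> v; have Av : A v by near: v; exact: withinT.
  apply: le_lt_trans (flip _ _ Au Av) _.
  apply: (@le_lt_trans _ _ ((`|L| + 1) * (c * `|u - v|))).
    apply: (@le_trans _ _ ((`|L| + 1) * frobnorm (u^T - v^T))).
      by rewrite ler_wpM2r ?frobnorm_ge0 //; have := ler_norm L; lra.
    by rewrite ler_wpM2l ?cle // ltW.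
  rewrite mulrA mulrC -ltr_pdivlMr ?mulr_gt0 //; near: v.
  apply: cvg_within.
  by apply: near_dist; rewrite divr_gt0 ?mulr_gt0.
move=> u /set_mem Au umin; exists u^T => // v Av.
by rewrite -(trmxK v); apply: umin; rewrite inE /A /= trmxK.
Unshelve. all: by end_near. Qed.

End Frobenius.

(** * Quadratic forms, eigenvalues and quasi-Newton iteration *)

Section Spectral.
Context {R : realType}.

Lemma frobdot0r q r (A : 'M[R]_(q, r)) : frobdot A 0 = 0.
Proof. by rewrite -(scale0r (0 : 'M[R]_(q, r))) frobdotZr mul0r. Qed.

Lemma frobnorm_mulmx q r s (A : 'M[R]_(q, r)) (B : 'M[R]_(r, s)) :
  frobnorm (A *m B) <= frobnorm A * frobnorm B.
Proof.
rewrite -ler_sqr ?nnegrE ?mulr_ge0 ?frobnorm_ge0 // exprMn !sqr_frobnorm.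
rewrite [X in _ * X]exchange_big /= mulr_suml.
apply: ler_sum => i _; rewrite mulr_sumr; apply: ler_sum => j _.
by rewrite mxE; exact: (sqr_sum_mul_le (fun k => A i k) (fun k => B k j)).
Qed.

Lemma frobdot_mulmx q r (A : 'M[R]_(q, r)) (u : 'cV[R]_q) (v : 'cV[R]_r) :
  frobdot u (A *m v) = frobdot (A^T *m u) v.
Proof. by rewrite -!trmx_mul_frobdot trmx_mul trmxK mulmxA. Qed.

(** A minimiser of the Rayleigh quotient is an eigenvector, because the
    nonnegative form of [A - mu] vanishes there and hence so does its
    gradient. *)
Lemma rayleigh_min q (A : 'M[R]_q) : (0 < q)%N -> A^T = A ->
  exists2 mu, eigenvalue A mu &
    forall u : 'cV[R]_q, mu * frobnorm u ^+ 2 <= frobdot u (A *m u).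
Proof.
case: q A => // q A _ Asym.
pose f (u : 'cV[R]_q.+1) := frobdot u (A *m u).
pose g (u : 'cV[R]_q.+1) := `|frobnorm u - 1|.
have gP u : (g u <= 0) = (frobnorm u == 1) by rewrite normr_le0 subr_eq0.
pose e : 'cV[R]_q.+1 := delta_mx 0 0.
have e1 : g e <= 0.
  rewrite gP -(@eqrXn2 _ 2) ?frobnorm_ge0 // expr1n sqr_frobnorm.
  rewrite (bigD1 ord0) //= big_ord1 mxE !eqxx expr1n big1 ?addr0 // => i i0.
  by rewrite big_ord1 mxE (negbTE i0) expr0n.
have [||| u0 gu0 u0min] := @frob_attains_min R _ g f (2 * frobnorm A) 1 e e1.
- by move=> u; rewrite gP => /eqP ->.
- move=> u v; rewrite /g; apply: le_trans (ler_dist_dist _ _) _.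
  by rewrite opprB addrA subrK ler_frobdist.
- move=> u v; rewrite !gP => /eqP u1 /eqP v1.
  have -> : f u - f v = frobdot (u - v) (A *m u) + frobdot v (A *m (u - v)).
    by rewrite frobdotBl mulmxBr frobdotBr /f; ring.
  have := ler_normD (frobdot (u - v) (A *m u)) (frobdot v (A *m (u - v))).
  have := frobdot_le (u - v) (A *m u); have := frobdot_le v (A *m (u - v)).
  have := frobnorm_mulmx A u; have := frobnorm_mulmx A (u - v).
  by rewrite u1 v1; have := frobnorm_ge0 (u - v); nra.
have {gu0} u01 : frobnorm u0 = 1 by apply/eqP; rewrite -gP.
set mu := f u0.
have lowf u : mu * frobnorm u ^+ 2 <= f u.
  have [->|u_neq0] := eqVneq u 0.
    by rewrite frobnorm0 expr0n /= mulr0 /f mulmx0 frobdot0r.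
  have nu0 : 0 < frobnorm u by rewrite lt_def frobnorm_eq0 u_neq0 frobnorm_ge0.
  have : mu <= f ((frobnorm u)^-1 *: u).
    apply: u0min; rewrite gP frobnormZ ger0_norm ?invr_ge0 ?ltW //.
    by rewrite mulVf // gt_eqF.
  by rewrite /f -scalemxAr frobdotZl frobdotZr mulrA -invfM mulrC ler_pdivlMr
    ?mulr_gt0 // expr2.
exists mu => //.
have [v vE] : exists v, v = A *m u0 - mu *: u0 by eexists.
pose c := frobnorm v ^+ 2.
pose dd := f v - mu * frobnorm v ^+ 2.
have dd0 : 0 <= dd by rewrite subr_ge0.
(* f - mu |.|^2 is nonnegative everywhere and vanishes at u0; along the ray
   u0 + t v its linear coefficient 2 c must therefore vanish. *)
have quad t : 0 <= t *+ 2 * c + t ^+ 2 * dd.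
  have := lowf (u0 + t *: v); rewrite -subr_ge0 => /le_trans; apply.
  rewrite -frobdotxx /f mulmxDr -scalemxAr.
  rewrite !(frobdotDl, frobdotDr, frobdotZl, frobdotZr) !frobdotxx u01.
  have -> : frobdot u0 (A *m v) = frobdot v (A *m u0).
    by rewrite frobdot_mulmx Asym frobdotC.
  have -> : c = frobdot v (A *m u0) - mu * frobdot v u0.
    by rewrite /c -frobdotxx {2}vE frobdotBr frobdotZr.
  rewrite (frobdotC u0 v) /dd /mu /f; lra.
have c0 : c = 0.
  have c_ge0 : 0 <= c by exact: sqr_ge0.
  have d1 : 0 < dd + 1 by lra.
  (* The shift by one avoids dividing by zero when dd = 0. *)
  have := quad (- (c / (dd + 1))); set x := c / _ => Hx.
  have cE : c = x * (dd + 1) by rewrite /x divfK ?gt_eqF.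
  have x0 : 0 <= x by rewrite divr_ge0 // ltW.
  move: Hx; rewrite {1}cE => Hx; have : x ^+ 2 <= 0 by nra.
  rewrite le_eqVlt ltNge sqr_ge0 orbF sqrf_eq0 => /eqP x00.
  by rewrite cE x00 mul0r.
have Au : A *m u0 = mu *: u0.
  by apply/eqP; rewrite -subr_eq0 -vE -frobnorm_eq0 -sqrf_eq0 -/c c0.
apply/eigenvalueP; exists u0^T.
  by rewrite -[in LHS]Asym -trmx_mul Au linearZ.
apply/eqP => /(congr1 trmx); rewrite trmxK trmx0 => u00.
by move: u01; rewrite u00 frobnorm0 => /esym/eqP; rewrite oner_eq0.
Qed.

Lemma eigenvalue_rayleigh q (A : 'M[R]_q) a : A^T = A -> eigenvalue A a ->
  exists2 u : 'cV[R]_q, 0 < frobnorm u & frobdot u (A *m u) = a * frobnorm u ^+ 2.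
Proof.
move=> Asym /eigenvalueP[v vA v0]; exists v^T.
  rewrite lt_def frobnorm_ge0 frobnorm_eq0 andbT; apply: contraNneq v0.
  by move=> /(congr1 trmx); rewrite trmxK trmx0 => ->.
by rewrite -[in LHS]Asym -trmx_mul vA linearZ /= frobdotZr frobdotxx.
Qed.

Lemma rayleigh_max q (A : 'M[R]_q) : (0 < q)%N -> A^T = A ->
  exists2 mu, eigenvalue A mu &
    forall u : 'cV[R]_q, frobdot u (A *m u) <= mu * frobnorm u ^+ 2.
Proof.
move=> q0 Asym; have [|mu Amu muP] := @rayleigh_min _ (- A) q0.
  by rewrite linearN /= Asym.
exists (- mu).
  move/eigenvalueP: Amu => [v vA v0]; apply/eigenvalueP; exists v => //.
  by rewrite scaleNr -vA mulmxN opprK.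
by move=> u; have := muP u; rewrite mulNmx frobdotC frobdotNl frobdotC; lra.
Qed.

Lemma cV0_eq0 q (u : 'cV[R]_q) : ~~ (0 < q)%N -> u = 0.
Proof.
rewrite -eqn0Ngt => /eqP q0.
by apply/matrixP => -[i iq]; exfalso; move: iq; rewrite q0.
Qed.

(** [lambda_min] is an infimum over the set of all eigenvalues, so besides the
    minimal Rayleigh value being an eigenvalue this needs it to bound all the
    others from below. *)
Lemma lambda_min_form q (A : 'M[R]_q) (u : 'cV[R]_q) : A^T = A ->
  lambda_min A * frobnorm u ^+ 2 <= frobdot u (A *m u).
Proof.
move=> Asym; have [q0|/(cV0_eq0 u) ->] := boolP (0 < q)%N; last first.
  by rewrite frobnorm0 expr0n /= mulr0 mulmx0 frobdot0r.
have [mu Amu muP] := rayleigh_min q0 Asym.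
apply: le_trans (muP u); rewrite ler_wpM2r ?sqr_ge0 //.
apply: ge_inf => //; exists mu => a /= Aa.
have [v v0 va] := eigenvalue_rayleigh Asym Aa.
by have := muP v; rewrite va ler_pM2r ?exprn_gt0.
Qed.

Lemma lambda_max_form q (A : 'M[R]_q) (u : 'cV[R]_q) : A^T = A ->
  frobdot u (A *m u) <= lambda_max A * frobnorm u ^+ 2.
Proof.
move=> Asym; have [q0|/(cV0_eq0 u) ->] := boolP (0 < q)%N; last first.
  by rewrite frobnorm0 expr0n /= mulr0 mulmx0 frobdot0r.
have [mu Amu muP] := rayleigh_max q0 Asym.
apply: le_trans (muP u) _; rewrite ler_wpM2r ?sqr_ge0 //.
apply: ub_le_sup => //; exists mu => a /= Aa.
have [v v0 va] := eigenvalue_rayleigh Asym Aa.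
by have := muP v; rewrite va ler_pM2r ?exprn_gt0.
Qed.

Lemma eigenvalue_bounds_form q (A : 'M[R]_q) c C (u : 'cV[R]_q) : A^T = A ->
  (forall a, eigenvalue A a -> c <= a <= C) ->
  c * frobnorm u ^+ 2 <= frobdot u (A *m u) <= C * frobnorm u ^+ 2.
Proof.
move=> Asym cC; have [q0|/(cV0_eq0 u) ->] := boolP (0 < q)%N; last first.
  by rewrite frobnorm0 expr0n /= !mulr0 mulmx0 frobdot0r lexx.
have [mu /cC /andP[cmu _] muP] := rayleigh_min q0 Asym.
have [nu /cC /andP[_ nuC] nuP] := rayleigh_max q0 Asym.
by apply/andP; split; [apply: le_trans (muP u)|apply: le_trans (nuP u) _];
  rewrite ler_wpM2r ?sqr_ge0.
Qed.

Lemma frobdot_delta q (i : 'I_q) (u : 'cV[R]_q) : frobdot (delta_mx i 0) u = u i 0.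
Proof.
rewrite /frobdot (bigD1 i) //= big_ord1 mxE !eqxx mul1r big1 ?addr0 // => j ji.
by rewrite big_ord1 mxE (negbTE ji) mul0r.
Qed.

Lemma frobnorm_delta q (i : 'I_q) : frobnorm (delta_mx i 0 : 'cV[R]_q) ^+ 2 = 1.
Proof. by rewrite -frobdotxx frobdot_delta mxE !eqxx. Qed.

(** Polarisation: the form is nonnegative at [e_i + e_j] and at [e_i - e_j]. *)
Lemma entry_le_form q (A : 'M[R]_q) C i j : A^T = A ->
  (forall u : 'cV[R]_q, 0 <= frobdot u (A *m u) <= C * frobnorm u ^+ 2) ->
  `|A i j| <= C.
Proof.
move=> Asym form; pose e k : 'cV[R]_q := delta_mx k 0.
have Ae k l : frobdot (e k) (A *m e l) = A k l.
  by rewrite frobdot_delta -colE mxE.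
have /andP[_] := form (e i); have /andP[_] := form (e j).
rewrite !Ae !frobnorm_delta !mulr1.
have /andP[+ _] := form (e i + e j); have /andP[+ _] := form (e i - e j).
rewrite !(mulmxBr, mulmxDr) !(frobdotBl, frobdotBr, frobdotDl, frobdotDr) !Ae.
have -> : A j i = A i j by rewrite -[in LHS]Asym mxE.
by rewrite ler_norml => *; apply/andP; split; lra.
Qed.

Lemma unitmx_cker q (A : 'M[R]_q) :
  (forall u : 'cV[R]_q, A *m u = 0 -> u = 0) -> A \in unitmx.
Proof.
move=> kerA; rewrite -unitmx_tr -row_free_unit; apply: inj_row_free => v vA.
apply: trmx_inj; rewrite trmx0; apply: kerA.
by rewrite -[A]trmxK -trmx_mul vA trmx0.
Qed.

Lemma posdefmx_unit q (A : 'M[R]_q) : posdefmx A -> A \in unitmx.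
Proof.
move=> [_ Apos]; apply: unitmx_cker => u Au; apply/eqP; apply: contraT.
by move=> /Apos; rewrite -mulmxA Au mulmx0 mxE ltxx.
Qed.

Lemma posdefmx_inv_form q (A : 'M[R]_q) c C (u : 'cV[R]_q) :
  posdefmx A -> 0 < c -> (forall a, eigenvalue A a -> c <= a <= C) ->
  C^-1 * frobnorm u ^+ 2 <= frobdot u (invmx A *m u) <= c^-1 * frobnorm u ^+ 2.
Proof.
move=> Apos c0 cC; have uA := posdefmx_unit Apos.
apply: eigenvalue_bounds_form => [|a /eigenvalueP[v vA v0]].
  by rewrite trmx_inv Apos.1.
have vE : v = a *: (v *m A) by rewrite scalemxAl -vA mulmxKV.
have a0 : a != 0 by apply: contraNneq v0 => a0; rewrite vE a0 scale0r.
have /cC /andP[ca aC] : eigenvalue A a^-1.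
  by apply/eigenvalueP; exists v => //; rewrite {2}vE scalerA mulVf // scale1r.
have a_gt0 : 0 < a by rewrite -invr_gt0 (lt_le_trans c0).
rewrite -[a]invrK !lef_pV2 ?posrE ?invr_gt0 ?ca ?aC //.
by apply: lt_le_trans aC; rewrite invr_gt0.
Qed.

(** The distance [|F x - x|] attains its minimum over the ball, and applying
    [F] once more at a minimiser would halve it.  This works directly in the
    Frobenius norm, where the contraction constant lives. *)
Lemma frob_contraction_fixpoint q (F : 'cV[R]_q -> 'cV[R]_q)
    (x0 : 'cV[R]_q) (r : R) : 0 <= r ->
  (forall x y, frobnorm (x - x0) <= r -> frobnorm (y - x0) <= r ->
     frobnorm (F x - F y) <= 2^-1 * frobnorm (x - y)) ->
  frobnorm (F x0 - x0) <= 2^-1 * r ->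
  exists2 x, frobnorm (x - x0) <= r & F x = x.
Proof.
move=> r0 Fc Fx0.
pose g x := frobnorm (x - x0) - r; pose f x := frobnorm (F x - x).
have gP x : (g x <= 0) = (frobnorm (x - x0) <= r) by rewrite subr_le0.
have g0 : g x0 <= 0 by rewrite gP subrr frobnorm0.
have [||| x gx xmin] := @frob_attains_min R q g f 2 (r + frobnorm x0) x0 g0.
- move=> u; rewrite gP => ur; rewrite -[u](subrK x0).
  by apply: le_trans (ler_frobnormD _ _) _; rewrite lerD2r.
- move=> u v; rewrite /g opprB addrA subrK; apply: le_trans (ler_frobdist _ _) _.
  by rewrite opprB addrA subrK.
- move=> u v; rewrite !gP => ur vr; apply: le_trans (ler_frobdist _ _) _.
  rewrite (_ : F u - u - (F v - v) = (F u - F v) + (v - u)); last first.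
    by apply/matrixP => i j; rewrite !mxE; ring.
  apply: le_trans (ler_frobnormD _ _) _; rewrite (frobnormB v u).
  by have := Fc u v ur vr; have := frobnorm_ge0 (u - v); lra.
move: gx; rewrite gP => xr; exists x => //; apply/eqP.
have Fxr : frobnorm (F x - x0) <= r.
  rewrite -[F x](subrK (F x0)) -addrA; apply: le_trans (ler_frobnormD _ _) _.
  by have := Fc x x0 xr; rewrite subrr frobnorm0 => /(_ r0); lra.
have := xmin (F x); rewrite gP => /(_ Fxr); rewrite /f.
have := Fc (F x) x Fxr xr; rewrite -subr_eq0 -frobnorm_eq0 eq_le frobnorm_ge0.
by rewrite andbT; have := frobnorm_ge0 (F x - x); lra.
Qed.

(** A root of [S] is a fixed point of the quasi-Newton map
    [x + H^-1 S(x)]; it is a contraction as soon as [-H] approximates every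
    difference quotient of [S] to within half of the coercivity of [H]. *)
Lemma quasi_newton_root q (S : 'cV[R]_q -> 'cV[R]_q) (H : 'M[R]_q)
    (x0 : 'cV[R]_q) (r k : R) :
  0 <= r -> 0 < k ->
  (forall u : 'cV[R]_q, k * frobnorm u ^+ 2 <= frobdot u (H *m u)) ->
  (forall x y, frobnorm (x - x0) <= r -> frobnorm (y - x0) <= r ->
     frobnorm (S x - S y + H *m (x - y)) <= 2^-1 * k * frobnorm (x - y)) ->
  frobnorm (S x0) <= 2^-1 * k * r ->
  exists2 x, S x = 0 & frobnorm (x - x0) <= r.
Proof.
move=> r0 k0 Hk SH Sx0.
have Hlow (u : 'cV[R]_q) : k * frobnorm u <= frobnorm (H *m u).
  have [->|u0] := eqVneq u 0; first by rewrite frobnorm0 mulr0 frobnorm_ge0.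
  have nu0 : 0 < frobnorm u by rewrite lt_def frobnorm_eq0 u0 frobnorm_ge0.
  rewrite -(ler_pM2l nu0).
  have := frobdot_le u (H *m u); have := ler_norm (frobdot u (H *m u)).
  by have := Hk u; lra.
have uH : H \in unitmx.
  apply: unitmx_cker => u Hu; have := Hlow u; rewrite Hu frobnorm0.
  rewrite pmulr_rle0 // => u0; apply/eqP.
  by rewrite -frobnorm_eq0 eq_le u0 frobnorm_ge0.
have Hinv (v : 'cV[R]_q) b : frobnorm v <= 2^-1 * k * b -> frobnorm (invmx H *m v) <= 2^-1 * b.
  move=> vb; rewrite -(ler_pM2l k0); apply: le_trans (Hlow _) _.
  by rewrite mulKVmx //; lra.
have [||x xr xE] := @frob_contraction_fixpoint q (fun x => x + invmx H *m S x) x0 r r0.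
- move=> x y xr yr; have := Hinv _ _ (SH x y xr yr).
  by rewrite mulmxDr mulKmx // mulmxBr addrC opprD addrACA.
- by rewrite addrC addKr; exact: Hinv.
exists x => //; move/eqP: xE; rewrite -subr_eq0 addrC addKr => /eqP/(congr1 (mulmx H)).
by rewrite mulKVmx // mulmx0.
Qed.

End Spectral.

(** * Second-order expansion of a logistic summand *)

Section LogisticCalculus.
Context {R : realType}.
Implicit Types (f df : R -> R) (s t y z : R).

Lemma mvt_near f df (a b z rho : R) :
  (forall x : R, is_derive x (1 : R) f (df x)) ->
  `|a - z| <= rho -> `|b - z| <= rho ->
  exists2 c, `|c - z| <= rho & f b - f a = df c * (b - a).
Proof.
move=> fdf; wlog ab : a b / a <= b.
  move=> W az bz; have [ab|/ltW ba] := leP a b; first exact: W.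
  have [c cz fE] := W _ _ ba bz az.
  by exists c => //; rewrite -opprB fE; ring.
rewrite !ler_norml => /andP[az1 az2] /andP[bz1 bz2].
have fcont : {within `[a, b], continuous f}.
  apply: continuous_subspaceT => x; apply: differentiable_continuous.
  by apply/derivable1_diffP; case: (fdf x).
have [c] := @MVT_segment R f df a b ab (fun x _ => fdf x) fcont.
rewrite in_itv /= => /andP[ac cb] fE; exists c => //.
by rewrite ler_norml; apply/andP; split; lra.
Qed.

(** The reference point [z] of the derivative is neither [s] nor [s'], so the
    error is bounded by the product of [|s - s'|] and the distance to [z]; this
    is what makes the remainder a perturbation with small Lipschitz constant. *)
Lemma second_order f df (ddf : R -> R) (L s s' z rho : R) :
  (forall x : R, is_derive x (1 : R) f (df x)) ->
  (forall x : R, is_derive x (1 : R) df (ddf x)) ->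
  (forall x : R, `|x - z| <= rho -> `|ddf x| <= L) ->
  `|s - z| <= rho -> `|s' - z| <= rho ->
  `|f s - f s' - df z * (s - s')| <= L * rho * `|s - s'|.
Proof.
move=> fdf dfddf Lb sz s'z.
have rho0 : 0 <= rho by apply: le_trans (normr_ge0 _) sz.
have [c cz ->] := mvt_near fdf s'z sz.
have [|e ez fE] := @mvt_near df ddf z c z rho dfddf _ cz; first by rewrite subrr normr0.
rewrite -mulrBl normrM ler_wpM2r // fE normrM.
by rewrite ler_pM // Lb.
Qed.

(** The standard deviation of the binary response as a function of the linear
    predictor, see [sd_sqrt]; in this form it has no square root to
    differentiate. *)
Definition sd t : R := (expR (t / 2) + expR (- (t / 2)))^-1.
Definition dsd t : R := - (expR (t / 2) - expR (- (t / 2))) / 2 * sd t ^+ 2.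
Definition ddsd t : R :=
  - sd t / 4 + (expR (t / 2) - expR (- (t / 2))) ^+ 2 / 2 * sd t ^+ 3.

(** The Pearson residual [(y - pi) / sd], see [pearsonE]. *)
Definition pearson y t : R := y * expR (- (t / 2)) - (1 - y) * expR (t / 2).
Definition dpearson y t : R :=
  - (y * expR (- (t / 2)) + (1 - y) * expR (t / 2)) / 2.

Lemma sd_den_gt0 t : 0 < expR (t / 2) + expR (- (t / 2)).
Proof. by rewrite addr_gt0 ?expR_gt0. Qed.

Lemma is_derive_exp_half t :
  is_derive t (1 : R) (fun x : R => expR (x / 2)) (expR (t / 2) / 2).
Proof.
have h : is_derive t (1 : R) (fun x : R => x / 2) 2^-1.
  have -> : (fun x : R => x / 2) = 2^-1 \*: (@id R).
    by apply/funext => x /=; rewrite /GRing.scale /= mulrC.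
  by apply: is_derive_eq; rewrite /GRing.scale /= mulr1.
exact: (@is_derive1_comp _ expR _ t _ _ (is_derive_expR _) h).
Qed.

Lemma is_derive_exp_Nhalf t :
  is_derive t (1 : R) (fun x : R => expR (- (x / 2))) (- expR (- (t / 2)) / 2).
Proof.
have h : is_derive t (1 : R) (fun x : R => - (x / 2)) (- 2^-1).
  have -> : (fun x : R => - (x / 2)) = (- 2^-1) \*: (@id R).
    by apply/funext => x /=; rewrite /GRing.scale /=; ring.
  by apply: is_derive_eq; rewrite /GRing.scale /= mulr1.
have := @is_derive1_comp _ expR _ t _ _ (is_derive_expR _) h.
by rewrite mulrN mulNr.
Qed.

Lemma is_derive_pearson y t :
  is_derive t (1 : R) (pearson y) (dpearson y t).
Proof.
have h1 := is_derive_exp_half t; have h2 := is_derive_exp_Nhalf t.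
have -> : pearson y = (y \*: (fun x : R => expR (- (x / 2)))) -
    ((1 - y) \*: (fun x : R => expR (x / 2))) by apply/funext.
by apply: is_derive_eq; rewrite /dpearson /GRing.scale /=; ring.
Qed.

Lemma is_derive_dpearson y t :
  is_derive t (1 : R) (dpearson y) (pearson y t / 4).
Proof.
have h1 := is_derive_exp_half t; have h2 := is_derive_exp_Nhalf t.
have -> : dpearson y = ((- y / 2) \*: (fun x : R => expR (- (x / 2)))) +
    ((- (1 - y) / 2) \*: (fun x : R => expR (x / 2))).
  apply/funext => x; transitivity (- y / 2 * expR (- (x / 2)) +
    - (1 - y) / 2 * expR (x / 2)) => //; rewrite /dpearson; by field.
apply: (is_derive_eq (is_deriveD (is_deriveZ _ h2) (is_deriveZ _ h1))).
by rewrite /pearson /GRing.scale /=; field.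
Qed.

Lemma is_derive_sd t : is_derive t (1 : R) sd (dsd t).
Proof.
have h1 := is_derive_exp_half t; have h2 := is_derive_exp_Nhalf t.
pose D := (fun x : R => expR (x / 2)) + (fun x : R => expR (- (x / 2))).
have D0 : D t != 0 by rewrite gt_eqF // sd_den_gt0.
have h3 := @is_deriveV _ D t _ 1 D0 (is_deriveD h1 h2).
have DE : D t = expR (t / 2) + expR (- (t / 2)) by [].
apply: (is_derive_eq h3); rewrite DE /dsd /sd /GRing.scale /=.
by field; rewrite gt_eqF // sd_den_gt0.
Qed.

Lemma is_derive_dsd t : is_derive t (1 : R) dsd (ddsd t).
Proof.
have h1 := is_derive_exp_half t; have h2 := is_derive_exp_Nhalf t.
have h3 := is_derive_sd t.
have -> : dsd = ((- 2^-1) \*: ((fun x : R => expR (x / 2)) -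
     (fun x : R => expR (- (x / 2))))) * (sd ^+ 2).
  apply/funext => x; transitivity (- 2^-1 * (expR (x / 2) - expR (- (x / 2))) *
    sd x ^+ 2) => //; rewrite /dsd; by ring.
apply: is_derive_eq; rewrite /ddsd /dsd !fctE /GRing.scale /=.
rewrite -[- 2^-1 *: _]/(- 2^-1 * _).
by rewrite /sd; field; rewrite gt_eqF // sd_den_gt0.
Qed.

Lemma sd_gt0 t : 0 < sd t. Proof. by rewrite invr_gt0 sd_den_gt0. Qed.

Lemma exp_half_mulN t : expR (t / 2) * expR (- (t / 2)) = 1.
Proof. by rewrite expRN mulfV // gt_eqF // expR_gt0. Qed.

Lemma sd_le1 t : sd t <= 1.
Proof.
rewrite invf_le1 ?sd_den_gt0 //; have := exp_half_mulN t.
have := expR_gt0 (t / 2); have := expR_gt0 (- (t / 2)); nra.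
Qed.

Lemma sd_mul_diff t : `|(expR (t / 2) - expR (- (t / 2))) * sd t| <= 1.
Proof.
rewrite normrM (gtr0_norm (sd_gt0 t)) ler_pdivrMr ?sd_den_gt0 // mul1r.
by apply: le_trans (ler_normB _ _) _; rewrite !gtr0_norm ?expR_gt0.
Qed.

Lemma dsd_bound t : `|dsd t| <= 1.
Proof.
have -> : dsd t = - ((expR (t / 2) - expR (- (t / 2))) * sd t) * (sd t / 2).
  by rewrite /dsd; ring.
rewrite normrM normrN; have := sd_mul_diff t; have := sd_le1 t; have := sd_gt0 t.
move=> h1 h2 h3; rewrite mulr_ile1 // gtr0_norm; lra.
Qed.

Lemma ddsd_bound t : `|ddsd t| <= 1.
Proof.
have := sd_mul_diff t; set z := _ * sd t => h.
have -> : ddsd t = sd t * (- 4^-1 + z ^+ 2 / 2).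
  by rewrite /ddsd /z; field.
have z1 : z ^+ 2 <= 1 by rewrite -(real_normK (num_real z)) expr_le1.
have z0 := sqr_ge0 z.
rewrite normrM mulr_ile1 //.
  by rewrite gtr0_norm ?sd_gt0 ?sd_le1.
by rewrite ler_norml; apply/andP; split; lra.
Qed.

Lemma exp_half_bounds t T : `|t| <= T ->
  expR (t / 2) <= expR (T / 2) /\ expR (- (t / 2)) <= expR (T / 2).
Proof.
by rewrite ler_norml => /andP[t1 t2]; rewrite !ler_expR; split; lra.
Qed.

Lemma pearson_bound y t T : 0 <= y <= 1 -> `|t| <= T ->
  `|pearson y t| <= expR (T / 2).
Proof.
move=> /andP[y0 y1] /exp_half_bounds[e1 e2]; rewrite ler_norml /pearson.
have := expR_gt0 (t / 2); have := expR_gt0 (- (t / 2)) => *.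
by apply/andP; split; nra.
Qed.

Lemma dpearson_bound y t T : 0 <= y <= 1 -> `|t| <= T ->
  `|dpearson y t| <= expR (T / 2).
Proof.
move=> /andP[y0 y1] /exp_half_bounds[e1 e2]; rewrite ler_norml /dpearson.
have := expR_gt0 (t / 2); have := expR_gt0 (- (t / 2)) => *.
by apply/andP; split; nra.
Qed.

Lemma sd_lower t T : `|t| <= T -> (2 * expR (T / 2))^-1 <= sd t.
Proof.
move=> /exp_half_bounds[e1 e2]; rewrite lef_pV2 ?posrE ?sd_den_gt0 //; first lra.
by rewrite mulr_gt0 // expR_gt0.
Qed.

(** The bound is proportional to the increments, not only to their squares:
    summed over the clusters it perturbs the slope of the estimating function
    by a fraction [rho] of its size. *)
Lemma summand_linearization y T rho s s' s0 t t' t0 :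
  0 <= y <= 1 -> 0 <= rho <= 1 -> `|s0| <= T -> `|t0| <= T ->
  `|s - s0| <= rho -> `|s' - s0| <= rho ->
  `|t - t0| <= rho -> `|t' - t0| <= rho ->
  `|sd s * pearson y t - sd s' * pearson y t'
     - dsd s0 * pearson y t0 * (s - s') - sd s0 * dpearson y t0 * (t - t')|
  <= 3 * expR ((T + 1) / 2) * rho * (`|s - s'| + `|t - t'|).
Proof.
move=> y01 /andP[rho0 rho1] s0T t0T ss0 s's0 tt0 t't0.
have near x : `|x - t0| <= rho -> `|x| <= T + 1.
  move=> xt; rewrite -(subrK t0 x); apply: le_trans (ler_normD _ _) _; lra.
have zz z : `|z - z| <= rho by rewrite subrr normr0.
set E := expR _; have E0 : 0 < E by exact: expR_gt0.
have t0T1 : `|t0| <= T + 1 by lra.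
have A1 := second_order is_derive_sd is_derive_dsd (fun x _ => ddsd_bound x) ss0 s's0.
have [c _ dsE] := mvt_near is_derive_sd (zz s0) s's0.
have [e ep dpE] := mvt_near (is_derive_pearson y) (zz t0) tt0.
have A2 := second_order (L := E) (is_derive_pearson y) (is_derive_dpearson y) _ tt0 t't0.
have {}A2 : `|pearson y t - pearson y t' - dpearson y t0 * (t - t')| <= E * rho * `|t - t'|.
  apply: A2 => x /near xT; have := pearson_bound y01 xT; rewrite -/E => pE.
  by rewrite normrM [X in _ * X]gtr0_norm //; have := normr_ge0 (pearson y x); lra.
(* Each factor is expanded with the other frozen, first at the moving point
   and then at the reference point. *)
rewrite (_ : _ - _ = (sd s - sd s' - dsd s0 * (s - s')) * pearson y t
   + dsd s0 * (pearson y t - pearson y t0) * (s - s')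
   + sd s' * (pearson y t - pearson y t' - dpearson y t0 * (t - t'))
   + (sd s' - sd s0) * dpearson y t0 * (t - t')); last by ring.
have B1 : `|(sd s - sd s' - dsd s0 * (s - s')) * pearson y t|
    <= rho * `|s - s'| * E.
  by rewrite normrM ler_pM // ?(pearson_bound y01 (near _ tt0)) // -[rho]mul1r.
have B2 : `|dsd s0 * (pearson y t - pearson y t0) * (s - s')|
    <= 1 * (E * rho) * `|s - s'|.
  rewrite (normrM _ (s - s')) (normrM (dsd s0)) ler_wpM2r //.
  apply: ler_pM => //; first exact: dsd_bound.
  rewrite dpE normrM; apply: ler_pM => //.
  exact: (dpearson_bound y01 (near _ ep)).
have B3 : `|sd s' * (pearson y t - pearson y t' - dpearson y t0 * (t - t'))|
    <= 1 * (E * rho * `|t - t'|).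
  by rewrite normrM ler_pM // gtr0_norm ?sd_gt0 ?sd_le1.
have B4 : `|(sd s' - sd s0) * dpearson y t0 * (t - t')| <= (1 * rho) * E * `|t - t'|.
  rewrite (normrM _ (t - t')) (normrM _ (dpearson y t0)) ler_wpM2r //.
  apply: ler_pM => //; first by rewrite dsE normrM ler_pM // dsd_bound.
  exact: (dpearson_bound y01 t0T1).
have d1 : 0 <= E * rho * `|s - s'| by rewrite !mulr_ge0 // ltW.
have d2 : 0 <= E * rho * `|t - t'| by rewrite !mulr_ge0 // ltW.
apply: le_trans (ler_normD _ _) _; apply: le_trans (lerD (ler_normD _ _) (lexx _)) _.
apply: le_trans (lerD (lerD (ler_normD _ _) (lexx _)) (lexx _)) _.
lra.
Qed.

Lemma sd_sqrt t :
  Num.sqrt (expR t / (1 + expR t) * (1 - expR t / (1 + expR t))) = sd t.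
Proof.
rewrite -[sd t]ger0_norm ?ltW ?sd_gt0 // -sqrtr_sqr; congr Num.sqrt.
have tE : expR t = expR (t / 2) ^+ 2 by rewrite expr2 -expRD -splitr.
rewrite /sd expRN tE; have := expR_gt0 (t / 2); move: (expR _) => x x0.
field; rewrite !gt_eqF //=; nra.
Qed.

Lemma pearsonE y t : pearson y t = (sd t)^-1 * (y - expR t / (1 + expR t)).
Proof.
have tE : expR t = expR (t / 2) ^+ 2 by rewrite expr2 -expRD -splitr.
rewrite /pearson /sd expRN tE invrK; have := expR_gt0 (t / 2).
by move: (expR _) => x x0; field; rewrite !gt_eqF //=; nra.
Qed.

(** At the truth the derivative splits into its mean, which builds the limiting
    slope, and a centred multiple of [y - pi]. *)
Lemma dpearsonE y t : dpearson y t =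
  - sd t - (2^-1 - expR t / (1 + expR t)) / sd t * (y - expR t / (1 + expR t)).
Proof.
have tE : expR t = expR (t / 2) ^+ 2 by rewrite expr2 -expRD -splitr.
rewrite /dpearson /sd expRN tE invrK; have := expR_gt0 (t / 2).
by move: (expR _) => x x0; field; rewrite !gt_eqF //=; nra.
Qed.

Lemma dsdE t :
  dsd t = (2^-1 - expR t / (1 + expR t)) * sd t.
Proof.
have tE : expR t = expR (t / 2) ^+ 2 by rewrite expr2 -expRD -splitr.
rewrite /dsd /sd expRN tE; have := expR_gt0 (t / 2).
by move: (expR _) => x x0; field; rewrite !gt_eqF //=; nra.
Qed.

(** Means bounded away from 0 and 1 confine the linear predictors at the truth
    to a fixed interval, whatever the dimension. *)
Lemma logit_bounded t b1 b2 : 0 < b1 -> b2 < 1 ->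
  b1 <= expR t / (1 + expR t) <= b2 -> `|t| <= `|ln b1| + `|ln (1 - b2)|.
Proof.
move=> b10 b21 /andP[lo hi]; have e0 := expR_gt0 t.
have e1 : 0 < 1 + expR t by lra.
move: lo hi; rewrite ler_pdivlMr // ler_pdivrMr // => lo hi.
have l1 : ln b1 <= t by rewrite -(expRK t) ler_ln ?posrE //; nra.
have l2 : ln (1 - b2) <= - t.
  rewrite -(expRK (- t)) ler_ln ?posrE ?expR_gt0 ?subr_gt0 //.
  by rewrite expRN -[leRHS]mul1r ler_pdivlMr //; nra.
have := ler_norm (- ln b1); have := ler_norm (- ln (1 - b2)); rewrite !normrN.
have := normr_ge0 (ln b1); have := normr_ge0 (ln (1 - b2)).
by rewrite ler_norml => *; apply/andP; split; lra.
Qed.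

End LogisticCalculus.

(** * Second moments of sums of independent binary responses *)

Section Moments.
Context {d : measure_display} {T : measurableType d} {R : realType}.
Variable P : probability T R.

Lemma bounded_integrable (f : T -> R) (M : R) : measurable_fun setT f ->
  (forall w, `|f w| <= M) -> P.-integrable setT (EFin \o f).
Proof.
move=> mf fM; apply: measurable_bounded_integrable => //.
  exact: le_lt_trans (probability_le1 P measurableT) (ltry _).
exists M; split; first exact: num_real.
by move=> x Mx w _; apply: le_trans (fM w) (ltW Mx).
Qed.

Section Binary.
Variables (n : nat) (Y : 'I_n -> {RV P >-> R}) (p : 'I_n -> R).
Hypothesis Y01 : forall i w, Y i w = 0 \/ Y i w = 1.
Hypothesis p01 : forall i, 0 <= p i <= 1.
Hypothesis Ymean : forall i, 'E_P[Y i]%E = (p i)%:E.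
Hypothesis Yindep : forall i j, i != j ->
  (P ([set w | Y i w = 1%R] `&` [set w | Y j w = 1%R]) =
   P [set w | Y i w = 1%R] * P [set w | Y j w = 1%R])%E.

Let mset i : measurable [set w | Y i w = 1].
Proof.
by rewrite (_ : [set w | _] = Y i @^-1` [set 1]) // -[X in measurable X]setTI.
Qed.

Lemma binary_indic i : Y i = \1_[set w | Y i w = 1] :> (T -> R).
Proof.
apply/funext => w; rewrite indicE; case: (Y01 i w) => Yw.
  rewrite memNset //= Yw => /eqP; by rewrite eq_sym oner_eq0.
by rewrite mem_set.
Qed.

Lemma binary_dev_le1 i w : `|Y i w - p i| <= 1.
Proof.
have /andP[p0 p1] := p01 i.
by case: (Y01 i w) => ->; rewrite ler_norml; apply/andP; split; lra.
Qed.

Lemma binary_dev_measurable i : measurable_fun setT (fun w => Y i w - p i).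
Proof. by apply: measurable_funB => //; exact: measurable_cst. Qed.

Let Yint i : (Y i : T -> R) \in Lfun P 1.
Proof.
apply/Lfun1_integrable; apply: (@bounded_integrable _ 1) => // w.
by case: (Y01 i w) => ->; rewrite ?normr0 ?normr1 ?ler01.
Qed.

(** Writing the responses as indicators turns the product rule for the two
    events into a vanishing covariance. *)
Lemma cov_eq0 i j : i != j ->
  (\int[P]_w ((Y i w - p i) * (Y j w - p j))%:E = 0)%E.
Proof.
move=> ij.
have YY : ((Y i : T -> R) * (Y j : T -> R))%R =
    \1_([set w | Y i w = 1] `&` [set w | Y j w = 1]) :> (T -> R).
  by rewrite indicI -!binary_indic.
have YYint : ((Y i : T -> R) * (Y j : T -> R))%R \in Lfun P 1.
  apply/Lfun1_integrable; rewrite YY; apply: (@bounded_integrable _ 1) => [|w].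
    by apply: measurable_indic; exact: measurableI.
  by rewrite indicE; case: (_ \in _); rewrite ?normr0 ?normr1 ?ler01.
have := covarianceE (Yint i) (Yint j) YYint.
rewrite YY expectation_indic ?Yindep //; last exact: measurableI.
rewrite -!expectation_indic // -!binary_indic !Ymean subee //.
by rewrite unlock /= !Ymean unlock.
Qed.

(** Expanding the square, only the diagonal survives, and a variance of a
    binary variable is at most one. *)
Lemma second_moment_le (c : 'I_n -> R) :
  (\int[P]_w ((\sum_i c i * (Y i w - p i)) ^+ 2)%:E <= (\sum_i c i ^+ 2)%:E)%E.
Proof.
pose e i w := Y i w - p i.
have int_ee i j : P.-integrable setT (EFin \o (fun w => e i w * e j w)).
  apply: (@bounded_integrable _ 1) => [|w].
    by apply: measurable_funM; exact: binary_dev_measurable.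
  by rewrite normrM mulr_ile1 // binary_dev_le1.
have -> : (\int[P]_w ((\sum_i c i * (Y i w - p i)) ^+ 2)%:E =
    \int[P]_w (\sum_(ij : 'I_n * 'I_n)
      (c ij.1 * c ij.2)%:E * (e ij.1 w * e ij.2 w)%:E))%E.
  apply: eq_integral => w _; rewrite expr2 big_distrlr /= pair_bigA /=.
  by rewrite -sumEFin; apply: eq_bigr => -[i j] _ /=; rewrite -EFinM mulrACA.
rewrite integral_sum //; last by move=> ij; exact: (integrableZl _ _ (int_ee _ _)).
pose F i j := (\int[P]_w ((c i * c j)%:E * (e i w * e j w)%:E))%E.
rewrite (eq_bigr (fun ij => F ij.1 ij.2)) // -(pair_bigA _ F) /= {}/F.
rewrite -sumEFin; apply: lee_sum => i _.
rewrite (bigD1 i) //= big1 ?adde0 => [|j ji]; last first.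
  by rewrite (integralZl _ (int_ee i j)) // cov_eq0 ?mule0 // eq_sym.
rewrite (integralZl _ (int_ee i i)) // -expr2 -[leRHS]mule1 lee_pmul //.
- by rewrite lee_fin sqr_ge0.
- by apply: integral_ge0 => w _; rewrite lee_fin -expr2 sqr_ge0.
apply: (@le_trans _ _ (\int[P]_w (cst 1%:E w))%E).
  apply: ge0_le_integral => //.
  - by move=> w _; rewrite lee_fin -expr2 sqr_ge0.
  - by case/integrableP: (int_ee i i).
  move=> w _; rewrite lee_fin -expr2 -(real_normK (num_real _)) expr_le1 //.
  exact: binary_dev_le1.
by rewrite integral_cst //= probability_setT mule1.
Qed.

End Binary.

Lemma markov_prob_ge (Q : T -> R) (eta K : R) : 0 < K ->
  measurable_fun setT Q -> (forall w, 0 <= Q w) ->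
  (\int[P]_w (Q w)%:E <= (eta * K)%:E)%E ->
  prob_ge P (1 - eta) [set w | Q w <= K].
Proof.
move=> K0 mQ Q0 QK; exists [set w | Q w < K]; split.
- rewrite (_ : [set w | Q w < K] = setT `&` Q @^-1` `]-oo, K[).
    by apply: mQ => //; exact: measurable_itv.
  by rewrite setTI; apply/seteqP; split=> w; rewrite /= in_itv.
- by move=> w /= /ltW.
have -> : [set w | Q w < K] = ~` [set w | K <= Q w].
  by apply/seteqP; split=> w /=; [move=> QwK; apply/negP|move/negP]; rewrite -ltNge.
have mKQ : measurable [set w | K <= Q w].
  rewrite (_ : [set w | K <= Q w] = setT `&` Q @^-1` `[K, +oo[).
    by apply: mQ => //; exact: measurable_itv.
  by rewrite setTI; apply/seteqP; split=> w; rewrite /= in_itv /= andbT.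
rewrite probability_setC // EFinB leeB //.
rewrite -(@lee_pmul2l _ K%:E) ?lte_fin // -EFinM mulrC.
apply: le_trans QK.
have mQE : measurable_fun setT (EFin \o Q) by exact/measurable_EFinP.
have := le_integral_abse P measurableT mQE K0; rewrite setTI /=.
rewrite (_ : [set x | _] = [set w | K <= Q w]); last first.
  by apply/seteqP; split=> w /=; rewrite lee_fin ger0_norm.
by under eq_integral do rewrite /= ger0_norm //.
Qed.

Lemma prob_geI (a b : R) (A B : set T) :
  prob_ge P (1 - a) A -> prob_ge P (1 - b) B -> prob_ge P (1 - (a + b)) (A `&` B).
Proof.
move=> [E [mE EA aE]] [F [mF FB bF]]; exists (E `&` F); split.
- exact: measurableI.
- by apply: setISS.
rewrite -[E `&` F]setCK probability_setC; last by apply: measurableC; exact: measurableI.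
rewrite setCI EFinB leeB // EFinD.
have CP G c : measurable G -> ((1 - c)%:E <= P G -> P (~` G) <= c%:E)%E.
  move=> mG; rewrite probability_setC //; have /fineK <- := fin_num_measure P _ mG.
  by rewrite -(EFinB 1) !lee_fin; lra.
apply: le_trans (measureU2 _ _ _) _; try exact: measurableC.
by apply: leeD; apply: CP.
Qed.

Lemma prob_ge_sub (a b : R) (A B : set T) : a <= b -> A `<=` B ->
  prob_ge P b A -> prob_ge P a B.
Proof.
move=> ab AB [E [mE EA bE]]; exists E; split => //; first exact: subset_trans AB.
by apply: le_trans bE; rewrite lee_fin.
Qed.

End Moments.

Section IndependentResponses.
Context {d : measure_display} {T : measurableType d} {R : realType}.
Variables (P : probability T R) (n m : nat) (Y : 'I_n -> 'I_m -> {RV P >-> R}).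
Variable p : 'I_n -> 'I_m -> R.
Hypothesis Y01 : forall i k w, Y i k w = 0 \/ Y i k w = 1.
Hypothesis p01 : forall i k, 0 <= p i k <= 1.
Hypothesis Ymean : forall i k, 'E_P[Y i k]%E = (p i k)%:E.
Hypothesis Yindep : indep_vectors P (fun i k => (Y i k : T -> R)).

Lemma indep_vectors_pair k i j : i != j ->
  (P ([set w | Y i k w = 1%R] `&` [set w | Y j k w = 1%R]) =
   P [set w | Y i k w = 1%R] * P [set w | Y j k w = 1%R])%E.
Proof.
move=> ij; have := Yindep (J := [set i; j]%SET) (E := fun l => [set w | Y l k w = 1]).
rewrite big_setU1 ?inE //= big_set1 => <-.
  congr (P _); apply/seteqP; split=> w /=.
    by move=> [Yi Yj] l /=; rewrite !inE => /orP[] /eqP ->.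
  by move=> h; split; apply: h; rewrite /= !inE eqxx ?orbT.
move=> l _; apply: sub_sigma_algebra; by exists k, [set 1].
Qed.

(** One application of Markov's inequality controls a whole family of sums at
    once; the family will be the entries of a vector or of a matrix, and the
    sum of squares its squared Frobenius norm.  Each member uses a single
    component [k t] of the clusters, so dependence within clusters does not
    matter. *)
Lemma weighted_sums_prob_ge (I : finType) (k : I -> 'I_m) (c : I -> 'I_n -> R)
    (eta K : R) : 0 < K ->
  \sum_t \sum_i c t i ^+ 2 <= eta * K ->
  prob_ge P (1 - eta)
    [set w | \sum_t (\sum_i c t i * (Y i (k t) w - p i (k t))) ^+ 2 <= K].
Proof.
move=> K0 cK.
have mS t : measurable_fun setT
    (fun w => (\sum_i c t i * (Y i (k t) w - p i (k t))) ^+ 2).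
  apply: measurable_funX; apply: measurable_sum => i.
  apply: measurable_funM; first exact: measurable_cst.
  by apply: measurable_funB => //; exact: measurable_cst.
apply: markov_prob_ge => //.
- exact: measurable_sum.
- by move=> w; apply: sumr_ge0 => t _; exact: sqr_ge0.
under eq_integral do rewrite -sumEFin.
rewrite ge0_integral_sum //; last by move=> t w _; rewrite lee_fin sqr_ge0.
  apply: (@le_trans _ _ (\sum_t \sum_i c t i ^+ 2)%:E); last by rewrite lee_fin.
  rewrite -sumEFin; apply: lee_sum => t _.
  apply: (@second_moment_le _ _ _ P n (fun i => Y i (k t)) (fun i => p i (k t))) => //.
  exact: indep_vectors_pair.
by move=> t; exact/measurable_EFinP.
Qed.

End IndependentResponses.

(** * Increments of the estimating function *)

Lemma sum_const_ord {R : realType} {m : nat} (M : R) :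
  \sum_(j < m) M = m%:R * M.
Proof. by rewrite sumr_const card_ord mulr_natl. Qed.

Lemma sum_jk_bound {R : realType} {m : nat} (F : 'I_m -> 'I_m -> R) M :
  (forall j k, F j k <= M) -> \sum_j \sum_k F j k <= m%:R ^+ 2 * M.
Proof.
move=> FM; apply: (@le_trans _ _ (\sum_(j < m) \sum_(k < m) M)).
  by do 2!apply: ler_sum => ? _.
by rewrite !sum_const_ord expr2 mulrA.
Qed.

Lemma sqrt_logit_var {R : realType} {m p : nat} (Xi : 'M[R]_(m, p)) b j :
  Num.sqrt (logit_var Xi b j) = sd ((Xi *m b) j 0).
Proof. by rewrite /logit_var mxE sd_sqrt. Qed.

Lemma whitened_residual {R : realType} {m p : nat} (Xi : 'M[R]_(m, p)) b y k :
  (Num.sqrt (logit_var Xi b k))^-1 * (y - logit_mean Xi b) k 0 =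
  pearson (y k 0) ((Xi *m b) k 0).
Proof.
rewrite sqrt_logit_var pearsonE; congr (_ * _).
by rewrite !mxE.
Qed.

Section EstimatingEquation.
Context {R : realType} {n m p : nat}.
Variables (X : 'I_n -> 'M[R]_(m, p)) (beta0 : 'cV[R]_p).

Definition linpred i j (b : 'cV[R]_p) : R := (X i *m b) j 0.
Definition mean0 i j : R := logit_mean (X i) beta0 j 0.
Definition sd0 i j : R := sd (linpred i j beta0).

(** The estimating function at the truth is a combination of the vectors
    [score_term], and the random part of its slope there a combination of the
    matrices [deriv_term1] and [deriv_term2]: these come from the derivatives
    in the first and in the second linear predictor of a summand.  The
    coefficients are the entries of the inverse working matrix, and [e] stands
    for the centred responses. *)
Definition score_weight i j k : R := sd0 i j / sd0 i k.
Definition deriv_weight1 i j k : R := (2^-1 - mean0 i j) * score_weight i j k.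
Definition deriv_weight2 i j k : R := - (2^-1 - mean0 i k) * score_weight i j k.

Definition score_term (e : 'I_n -> 'I_m -> R) j k : 'cV[R]_p :=
  \col_l \sum_i score_weight i j k * X i j l * e i k.
Definition deriv_term1 (e : 'I_n -> 'I_m -> R) j k : 'M[R]_p :=
  \matrix_(l, l') \sum_i deriv_weight1 i j k * X i j l * X i j l' * e i k.
Definition deriv_term2 (e : 'I_n -> 'I_m -> R) j k : 'M[R]_p :=
  \matrix_(l, l') \sum_i deriv_weight2 i j k * X i j l * X i k l' * e i k.

(** Minus the mean slope of the estimating function at the truth when the
    inverse working matrix is [V]. *)
Definition limit_jacobian (V : 'M[R]_m) : 'M[R]_p :=
  \sum_i (X i)^T *m (diag_mx (\row_j sd0 i j) *m V *m diag_mx (\row_j sd0 i j)) *m X i.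

Lemma linpredE i j b : linpred i j b = \sum_l X i j l * b l 0.
Proof. by rewrite /linpred mxE. Qed.

Lemma linpredB i j b c : linpred i j (b - c) = linpred i j b - linpred i j c.
Proof. by rewrite /linpred mulmxBr !mxE. Qed.

Lemma mean0E i j :
  mean0 i j = expR (linpred i j beta0) / (1 + expR (linpred i j beta0)).
Proof. by rewrite /mean0 mxE. Qed.

Lemma row_fun_entry (f : 'I_m -> R) j : (\row_j' f j') 0 j = f j.
Proof. by rewrite mxE. Qed.

Lemma sandwich_entry (D1 D2 : 'rV[R]_m) (Q : 'M[R]_m) (e : 'cV[R]_m) j :
  (diag_mx D1 *m Q *m diag_mx D2 *m e) j 0 =
  \sum_k Q j k * (D1 0 j * (D2 0 k * e k 0)).
Proof.
rewrite -!mulmxA mul_diag_mx !mxE mulr_sumr; apply: eq_bigr => k _.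
by rewrite mul_diag_mx !mxE; ring.
Qed.

Lemma frobdot_sandwich i (D1 D2 : 'rV[R]_m) (Q : 'M[R]_m) (e : 'cV[R]_m) u :
  frobdot u ((X i)^T *m diag_mx D1 *m Q *m diag_mx D2 *m e) =
  \sum_j \sum_k Q j k * (D1 0 j * (D2 0 k * e k 0)) * linpred i j u.
Proof.
rewrite -!mulmxA frobdot_mulmx trmxK frobdotC /frobdot.
apply: eq_bigr => j _; rewrite big_ord1 !mulmxA sandwich_entry mulr_suml.
by apply: eq_bigr => k _.
Qed.

Lemma frobdot_estfun (y : 'I_n -> 'cV[R]_m) W b u :
  frobdot u (estfun X y W b) = \sum_i \sum_j \sum_k
    invmx W j k * (sd (linpred i j b) * pearson (y i k 0) (linpred i k b))
      * linpred i j u.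
Proof.
rewrite frobdotC frobdot_suml; apply: eq_bigr => i _.
rewrite frobdotC frobdot_sandwich; do 2!apply: eq_bigr => ? _.
by rewrite !row_fun_entry sqrt_logit_var whitened_residual.
Qed.

Lemma frobdot_limit_jacobian V u v :
  frobdot u (limit_jacobian V *m v) = \sum_i \sum_j \sum_k
    V j k * (sd0 i j * sd0 i k) * linpred i k v * linpred i j u.
Proof.
rewrite mulmx_suml frobdotC frobdot_suml; apply: eq_bigr => i _.
rewrite frobdotC !mulmxA -[_ *m X i *m v]mulmxA frobdot_sandwich; do 2!apply: eq_bigr => ? _.
by rewrite !row_fun_entry -/(linpred _ _ _); ring.
Qed.

(** Turns the double sum produced by the expansion into the bilinear form of a
    matrix that does not depend on the directions, so that a bound in
    probability on its norm is uniform over the ball. *)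
Lemma bilinear_weighted_sum (N : 'M[R]_p) (w : 'I_n -> R) (j k : 'I_m)
    (e : 'I_n -> R) u v :
  (forall l l', N l l' = \sum_i w i * X i j l * X i k l' * e i) ->
  \sum_i w i * e i * linpred i k v * linpred i j u = frobdot u (N *m v).
Proof.
move=> NE.
transitivity (\sum_i \sum_l \sum_l' u l 0 * (w i * X i j l * X i k l' * e i * v l' 0)).
  apply: eq_bigr => i _; rewrite !linpredE mulr_sumr; apply: eq_bigr => l _.
  by rewrite mulr_sumr mulr_suml; apply: eq_bigr => l' _; ring.
rewrite exchange_big; apply: eq_bigr => l _ /=.
rewrite big_ord1 mxE exchange_big mulr_sumr; apply: eq_bigr => l' _ /=.
by rewrite NE mulr_suml mulr_sumr.
Qed.

Section Root.
Variables (y : 'I_n -> 'cV[R]_m) (W V : 'M[R]_m).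
Let e i k := y i k 0 - mean0 i k.
Variables (T xi rho r q kappa a B v0 mu nu : R).
Hypotheses (y01 : forall i k, 0 <= y i k 0 <= 1)
  (linpred0_le : forall i j, `|linpred i j beta0| <= T)
  (linpred_le : forall i j u, `|linpred i j u| <= xi * frobnorm u)
  (r0 : 0 <= r) (xir : xi * r <= rho) (rho1 : rho <= 1)
  (xi0 : 0 <= xi)
  (q0 : 0 <= q) (Wq : forall j k, `|invmx W j k| <= q)
  (kappa0 : 0 <= kappa) (WV : forall j k, `|V j k - invmx W j k| <= kappa)
  (a0 : 0 < a) (gram_low : forall u, a * frobnorm u ^+ 2 <= \sum_i \sum_j linpred i j u ^+ 2)
  (gram_up : forall u, \sum_i \sum_j linpred i j u ^+ 2 <= B * frobnorm u ^+ 2)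
  (v0_gt0 : 0 < v0)
  (V_low : forall z : 'cV[R]_m, v0 * frobnorm z ^+ 2 <= frobdot z (V *m z))
  (mu_ge0 : 0 <= mu)
  (deriv1 : forall j k, frobnorm (deriv_term1 e j k) <= mu)
  (deriv2 : forall j k, frobnorm (deriv_term2 e j k) <= mu)
  (score : forall j k, frobnorm (score_term e j k) <= nu).

Let E : R := expR ((T + 1) / 2).
Let kH : R := v0 * (2 * E) ^- 2 * a.
Let K : R := q * (3 * E * rho) * m%:R * B + m%:R ^+ 2 * q * mu + kappa * m%:R * B.

Hypotheses (K_small : 4 * K <= kH) (score_small : 2 * (m%:R ^+ 2 * q * nu) <= kH * r).

Let E_gt0 : 0 < E. Proof. exact: expR_gt0. Qed.

Lemma sd0_lower i j : (2 * E)^-1 <= sd0 i j.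
Proof.
apply: le_trans (sd_lower (linpred0_le i j)).
rewrite lef_pV2 ?posrE ?mulr_gt0 ?expR_gt0 // ler_pM2l // ler_expR; lra.
Qed.

(** [V] bounds the form below cluster by cluster, the standard deviations are
    at least [1 / (2 E)], and the Gram matrix does the rest. *)
Lemma limit_jacobian_coercive (u : 'cV[R]_p) :
  kH * frobnorm u ^+ 2 <= frobdot u (limit_jacobian V *m u).
Proof.
rewrite frobdot_limit_jacobian.
pose z i : 'cV[R]_m := \col_j (sd0 i j * linpred i j u).
have zE i j : z i j 0 = sd0 i j * linpred i j u by rewrite mxE.
have -> : \sum_i \sum_j \sum_k V j k * (sd0 i j * sd0 i k) * linpred i k u *
    linpred i j u = \sum_i frobdot (z i) (V *m z i).
  apply: eq_bigr => i _; rewrite /frobdot; apply: eq_bigr => j _.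
  rewrite big_ord1 zE mxE mulr_sumr; apply: eq_bigr => k _.
  by rewrite zE; ring.
apply: (@le_trans _ _ (\sum_i v0 * frobnorm (z i) ^+ 2)); last exact: ler_sum.
rewrite -mulr_sumr /kH -!mulrA ler_pM2l //.
apply: (@le_trans _ _ ((2 * E) ^- 2 * \sum_i \sum_j linpred i j u ^+ 2)).
  by rewrite ler_pM2l ?gram_low // invr_gt0 exprn_gt0 // mulr_gt0.
rewrite mulr_sumr; apply: ler_sum => i _; rewrite sqr_frobnorm mulr_sumr.
apply: ler_sum => j _; rewrite big_ord1 zE [in leRHS]exprMn ler_wpM2r ?sqr_ge0 //.
rewrite -exprVn ler_sqr ?nnegrE ?sd0_lower ?ltW ?sd_gt0 //.
by rewrite invr_gt0 mulr_gt0.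
Qed.

(** The mean slope at the truth carries the coefficients [invmx W j k]; the
    last sum is the error of replacing them by those of [V], which build the
    nonrandom matrix [limit_jacobian V]. *)
Lemma estfun_increment (u b c : 'cV[R]_p) :
  frobdot u (estfun X y W b - estfun X y W c + limit_jacobian V *m (b - c)) =
  \sum_i \sum_j \sum_k invmx W j k * linpred i j u *
    (sd (linpred i j b) * pearson (y i k 0) (linpred i k b)
     - sd (linpred i j c) * pearson (y i k 0) (linpred i k c)
     - dsd (linpred i j beta0) * pearson (y i k 0) (linpred i k beta0)
         * (linpred i j b - linpred i j c)
     - sd0 i j * dpearson (y i k 0) (linpred i k beta0)
         * (linpred i k b - linpred i k c))
  + \sum_j \sum_k invmx W j k * frobdot u (deriv_term1 e j k *m (b - c))
  + \sum_j \sum_k invmx W j k * frobdot u (deriv_term2 e j k *m (b - c))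
  + \sum_i \sum_j \sum_k (V j k - invmx W j k) * (sd0 i j * sd0 i k) *
      linpred i k (b - c) * linpred i j u.
Proof.
have D1 : \sum_j \sum_k invmx W j k * frobdot u (deriv_term1 e j k *m (b - c)) =
    \sum_i \sum_j \sum_k invmx W j k *
      (deriv_weight1 i j k * e i k * linpred i j (b - c) * linpred i j u).
  rewrite [RHS]exchange_big; apply: eq_bigr => j _; rewrite [RHS]exchange_big.
  apply: eq_bigr => k _; rewrite -mulr_sumr; congr (_ * _).
  by rewrite (bilinear_weighted_sum (N := deriv_term1 e j k)) // => l l'; rewrite mxE.
have D2 : \sum_j \sum_k invmx W j k * frobdot u (deriv_term2 e j k *m (b - c)) =
    \sum_i \sum_j \sum_k invmx W j k *
      (deriv_weight2 i j k * e i k * linpred i k (b - c) * linpred i j u).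
  rewrite [RHS]exchange_big; apply: eq_bigr => j _; rewrite [RHS]exchange_big.
  apply: eq_bigr => k _; rewrite -mulr_sumr; congr (_ * _).
  by rewrite (bilinear_weighted_sum (N := deriv_term2 e j k)) // => l l'; rewrite mxE.
rewrite D1 D2 frobdotDr frobdotBr !frobdot_estfun frobdot_limit_jacobian.
rewrite -sumrB -!big_split; apply: eq_bigr => i _.
rewrite -sumrB -!big_split; apply: eq_bigr => j _.
rewrite -sumrB -!big_split; apply: eq_bigr => k _ /=.
rewrite !linpredB dsdE dpearsonE (pearsonE _ (linpred i k beta0)).
rewrite /deriv_weight1 /deriv_weight2 /score_weight /e -!mean0E -!/(sd0 _ _).
have s_neq0 : sd0 i k != 0 by rewrite gt_eqF // sd_gt0.
by field.
Qed.

Lemma linpred_near i j (b : 'cV[R]_p) : frobnorm (b - beta0) <= r ->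
  `|linpred i j b - linpred i j beta0| <= rho.
Proof.
move=> br; rewrite -linpredB; apply: le_trans (linpred_le _ _ _) _.
by apply: le_trans xir; rewrite ler_wpM2l.
Qed.

(** The mixed products of linear predictors have been split by the
    arithmetic-geometric inequality beforehand, so that only the sums of
    squares bounded by the Gram matrix occur. *)
Lemma cross_sum_bound (N : R) (u v : 'cV[R]_p) (F : 'I_n -> 'I_m -> 'I_m -> R) :
  0 <= N ->
  (forall i j k, F i j k <= N * (linpred i j u ^+ 2 + linpred i j v ^+ 2 / 2
                                 + linpred i k v ^+ 2 / 2)) ->
  \sum_i \sum_j \sum_k F i j k <=
    N * m%:R * B * (frobnorm u ^+ 2 + frobnorm v ^+ 2).
Proof.
move=> N0 FN.
pose S w i := \sum_(j < m) linpred i j w ^+ 2.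
apply: (@le_trans _ _ (\sum_i N * m%:R * (S u i + S v i))).
  apply: ler_sum => i _.
  apply: (@le_trans _ _ (\sum_(j < m) \sum_(k < m) N * (linpred i j u ^+ 2 +
    linpred i j v ^+ 2 / 2 + linpred i k v ^+ 2 / 2))).
    by do 2!apply: ler_sum => ? _.
  under eq_bigr => j _.
    rewrite -mulr_sumr big_split sum_const_ord /= -mulr_suml.
    over.
  rewrite -mulr_sumr big_split /= sum_const_ord.
  rewrite -mulr_sumr big_split /= -mulr_suml -/(S u i) -/(S v i).
  by rewrite le_eqVlt; apply/orP; left; apply/eqP; field.
rewrite -mulr_sumr big_split /= -[leRHS]mulrA ler_wpM2l ?mulr_ge0 // mulrDr.
by rewrite lerD // gram_up.
Qed.

Lemma estfun_increment_le (u b c : 'cV[R]_p) :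
  frobnorm (b - beta0) <= r -> frobnorm (c - beta0) <= r ->
  frobdot u (estfun X y W b - estfun X y W c + limit_jacobian V *m (b - c)) <=
  K * (frobnorm u ^+ 2 + frobnorm (b - c) ^+ 2).
Proof.
move=> br cr; rewrite estfun_increment.
set v := b - c; set S := frobnorm u ^+ 2 + frobnorm v ^+ 2.
have rho0 : 0 <= rho by apply: le_trans xir; rewrite mulr_ge0.
have sd01 i j : 0 < sd0 i j <= 1 by rewrite sd_gt0 sd_le1.
have D_le (N : 'I_m -> 'I_m -> 'M[R]_p) : (forall j k, frobnorm (N j k) <= mu) ->
    \sum_j \sum_k invmx W j k * frobdot u (N j k *m v) <= m%:R ^+ 2 * (q * mu * (S / 2)).
  move=> Nmu; apply: sum_jk_bound => j k.
  apply: le_trans (ler_norm _) _; rewrite normrM -mulrA ler_pM ?Wq //.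
  apply: le_trans (frobdot_le _ _) _.
  apply: (@le_trans _ _ (frobnorm u * (mu * frobnorm v))).
    rewrite ler_wpM2l ?frobnorm_ge0 //; apply: le_trans (frobnorm_mulmx _ _) _.
    by rewrite ler_wpM2r ?frobnorm_ge0.
  rewrite mulrCA ler_wpM2l // /S.
  have := sqr_ge0 (frobnorm u - frobnorm v); lra.
have {D_le} := lerD (D_le _ deriv1) (D_le _ deriv2).
set D1 := \sum_j _; set D2 := \sum_j _ => D12.
have AM (x z : R) : `|x| * `|z| <= x ^+ 2 / 2 + z ^+ 2 / 2.
  rewrite -(real_normK (num_real x)) -(real_normK (num_real z)).
  have := sqr_ge0 (`|x| - `|z|); lra.
set T1 := \sum_i _; set T4 := (X in _ + X <= _).
have T1_le : T1 <= q * (3 * E * rho) * m%:R * B * S.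
  apply: cross_sum_bound => [|i j k]; first by rewrite !mulr_ge0 // ltW.
  apply: le_trans (ler_norm _) _; rewrite normrM (normrM (invmx W j k)).
  set Rem := `|_ - _ - _ - _|.
  have RemE : Rem <= 3 * E * rho * (`|linpred i j v| + `|linpred i k v|).
    rewrite /v !linpredB; apply: summand_linearization.
    - exact: y01.
    - by rewrite rho0 rho1.
    - exact: linpred0_le.
    - exact: linpred0_le.
    - exact: linpred_near.
    - exact: linpred_near.
    - exact: linpred_near.
    - exact: linpred_near.
  apply: (@le_trans _ _ (q * `|linpred i j u| *
      (3 * E * rho * (`|linpred i j v| + `|linpred i k v|)))).
    have Rem0 : 0 <= 3 * E * rho * (`|linpred i j v| + `|linpred i k v|).
      exact: le_trans (normr_ge0 _) RemE.
    have Qu : `|invmx W j k| * `|linpred i j u| <= q * `|linpred i j u|.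
      exact: ler_wpM2r.
    exact: le_trans (ler_wpM2l (mulr_ge0 _ _) RemE) (ler_wpM2r Rem0 Qu).
  rewrite (_ : _ * _ = q * (3 * E * rho) * (`|linpred i j u| * `|linpred i j v| +
    `|linpred i j u| * `|linpred i k v|)); last by ring.
  apply: ler_wpM2l; first by rewrite !mulr_ge0 // ltW.
  have := AM (linpred i j u) (linpred i j v).
  have := AM (linpred i j u) (linpred i k v); lra.
have T4_le : T4 <= kappa * m%:R * B * S.
  apply: cross_sum_bound => // i j k.
  apply: le_trans (ler_norm _) _; rewrite !normrM.
  have /andP[/ltW sj0 sj1] := sd01 i j; have /andP[/ltW sk0 sk1] := sd01 i k.
  rewrite (ger0_norm sj0) (ger0_norm sk0).
  apply: (@le_trans _ _ (kappa * (`|linpred i k v| * `|linpred i j u|))).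
    rewrite -!mulrA ler_pM ?WV // ?mulr_ge0 //.
    rewrite mulrA -[leRHS]mul1r ler_wpM2r ?mulr_ge0 //; nra.
  rewrite ler_wpM2l //; have := AM (linpred i k v) (linpred i j u).
  have := sqr_ge0 (linpred i j u); have := sqr_ge0 (linpred i j v); lra.
rewrite /K; lra.
Qed.

(** The bound is linear in [u] on the left and quadratic on the right; taking
    for [u] a suitable multiple of the increment itself gives its norm. *)
Lemma estfun_increment_norm (b c : 'cV[R]_p) :
  frobnorm (b - beta0) <= r -> frobnorm (c - beta0) <= r ->
  frobnorm (estfun X y W b - estfun X y W c + limit_jacobian V *m (b - c))
  <= 2^-1 * kH * frobnorm (b - c).
Proof.
move=> br cr; set D := _ + _.
have kH0 : 0 < kH by rewrite !mulr_gt0 // invr_gt0 exprn_gt0 // mulr_gt0.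
have c2 : 0 <= 2 / kH by apply: divr_ge0 => //; exact: ltW.
have := @estfun_increment_le ((2 / kH) *: D) b c br cr.
rewrite -/D frobdotZl frobdotxx frobnormZ ger0_norm //.
set N := frobnorm D; set dl := frobnorm (b - c) => H.
have {}H : 2 / kH * N ^+ 2 <= kH / 4 * ((2 / kH * N) ^+ 2 + dl ^+ 2).
  have K4 : K <= kH / 4 by rewrite ler_pdivlMr // mulrC.
  exact: le_trans H (ler_wpM2r (addr_ge0 (sqr_ge0 _) (sqr_ge0 _)) K4).
have N0 : 0 <= N by exact: frobnorm_ge0.
have d0 : 0 <= dl by exact: frobnorm_ge0.
have kHd0 : 0 <= 2^-1 * kH * dl.
  by apply: mulr_ge0 => //; apply: mulr_ge0; [rewrite invr_ge0|exact: ltW].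
rewrite -ler_sqr ?nnegrE //.
have H2 : N ^+ 2 / kH <= kH / 4 * dl ^+ 2.
  have E2 : kH / 4 * (2 / kH * N) ^+ 2 = N ^+ 2 / kH by field; rewrite gt_eqF.
  by move: H; rewrite mulrDr E2; lra.
move: H2; rewrite ler_pdivrMr //; lra.
Qed.

Lemma estfun_at_truth_norm : frobnorm (estfun X y W beta0) <= m%:R ^+ 2 * q * nu.
Proof.
have -> : estfun X y W beta0 = \sum_j \sum_k invmx W j k *: score_term e j k.
  apply/matrixP => l l'; rewrite (ord1 l') -!frobdot_delta frobdot_estfun.
  rewrite frobdotC frobdot_suml exchange_big; apply: eq_bigr => j _ /=.
  rewrite frobdot_suml exchange_big; apply: eq_bigr => k _ /=.
  rewrite frobdotC frobdotZr frobdot_delta mxE mulr_sumr; apply: eq_bigr => i _.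
  rewrite pearsonE -mean0E -!/(sd0 _ _) /score_weight /e.
  have -> : linpred i j (delta_mx l 0) = X i j l by rewrite /linpred -colE mxE.
  by ring.
have normr_sum (I : finType) (F : I -> 'cV[R]_p) :
    frobnorm (\sum_i F i) <= \sum_i frobnorm (F i).
  apply: (big_ind2 (fun x z => frobnorm x <= z)); first by rewrite frobnorm0.
  - by move=> x1 x2 z1 z2 h1 h2; apply: le_trans (ler_frobnormD _ _) (lerD h1 h2).
  - by [].
apply: le_trans (normr_sum _ _) _; rewrite -mulrA.
apply: le_trans (ler_sum _ (fun j _ => normr_sum _ _)) _.
apply: sum_jk_bound => j k; rewrite frobnormZ.
by rewrite ler_pM ?frobnorm_ge0.
Qed.

Lemma estfun_root : exists2 b, estfun X y W b = 0 & frobnorm (b - beta0) <= r.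
Proof.
have kH0 : 0 < kH by rewrite !mulr_gt0 // invr_gt0 exprn_gt0 // mulr_gt0.
apply: (quasi_newton_root (H := limit_jacobian V) r0 kH0).
- exact: limit_jacobian_coercive.
- exact: estfun_increment_norm.
- by apply: le_trans estfun_at_truth_norm _; rewrite -[leRHS]mulrA ler_pdivlMl.
Qed.

End Root.
End EstimatingEquation.

(** * The root at a fixed sample size *)

(** Explicit constants, in which only [m], the probability level [eta] and the
    constants of the assumptions enter: that they do not involve [n] is what makes the conclusion uniform.
    The terms [+ 1] keep the second-moment bounds and the radius positive. *)
Section Constants.
Context {R : realType}.
Variables (m : nat) (T C M b3 b4 c CR eta : R).

Definition weight_bound : R := 2 * expR ((T + 1) / 2).
Definition score_const : R := m%:R ^+ 2 * (weight_bound * C) ^+ 2 / eta + 1.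
Definition deriv_const : R := m%:R ^+ 2 * (weight_bound * C ^+ 2) ^+ 2 / eta + 1.
Definition jacobian_const : R := CR^-1 * weight_bound ^- 2 * b3.
Definition root_radius : R :=
  2 * (m%:R ^+ 2 * (c^-1 + 1) * Num.sqrt score_const) / jacobian_const + 1.
Definition remainder_const : R :=
  (c^-1 + 1) * (3 * expR ((T + 1) / 2) * (C * root_radius)) * m%:R * b4
  + m%:R ^+ 2 * (c^-1 + 1) * Num.sqrt deriv_const + M * m%:R * b4.

End Constants.

Section FixedSample.
Context {R : realType} {d : measure_display} {Om : measurableType d}.
Context {P : probability Om R} {n m p : nat}.
Variables (X : 'I_n -> 'M[R]_(m, p)) (beta0 : 'cV[R]_p).
Variables (Y : 'I_n -> 'I_m -> {RV P >-> R}) (Rhat : Om -> 'M[R]_m) (Rbar : 'M[R]_m).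
Hypotheses (Y_binary : forall i j w, Y i j w = 0 \/ Y i j w = 1)
  (Y_indep : indep_vectors P (fun i j => (Y i j : Om -> R)))
  (Y_mean : forall i j, ('E_P[Y i j])%E = (logit_mean (X i) beta0 j 0)%:E).

Let e w i k : R := Y i k w - mean0 X beta0 i k.

Lemma mean0_itv i j : 0 <= mean0 X beta0 i j <= 1.
Proof.
rewrite mean0E; have := expR_gt0 (linpred X i j beta0) => h.
by rewrite divr_ge0 ?ler_pdivrMr ?mul1r; lra.
Qed.

(** All [m ^ 2] matrices are bounded simultaneously, as the coordinates of one
    family of sums. *)
Lemma frob_terms_prob_ge (s t : nat) (N : Om -> 'I_m -> 'I_m -> 'M[R]_(s, t))
    (c : 'I_m -> 'I_m -> 'I_s -> 'I_t -> 'I_n -> R) (D eta K : R) :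
  (forall w j k l l', N w j k l l' = \sum_i c j k l l' i * e w i k) ->
  (forall i j k, \sum_l \sum_l' c j k l l' i ^+ 2 <= D) ->
  0 < K -> m%:R ^+ 2 * (n%:R * D) <= eta * K ->
  prob_ge P (1 - eta) [set w | forall j k, frobnorm (N w j k) <= Num.sqrt K].
Proof.
move=> NE cD K0 DK.
pose I := ('I_m * 'I_m * ('I_s * 'I_t))%type.
pose cI (x : I) := c x.1.1 x.1.2 x.2.1 x.2.2.
have cIK : \sum_(x : I) \sum_i cI x i ^+ 2 <= eta * K.
  apply: le_trans DK.
  rewrite -(pair_bigA _ (fun jk ll => \sum_i c jk.1 jk.2 ll.1 ll.2 i ^+ 2)) /=.
  rewrite -(pair_bigA _ (fun j k => \sum_ll \sum_i c j k ll.1 ll.2 i ^+ 2)) /=.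
  apply: sum_jk_bound => j k.
  rewrite exchange_big /= -sum_const_ord; apply: ler_sum => i _.
  by rewrite -(pair_bigA _ (fun l l' => c j k l l' i ^+ 2)) /=.
have := @weighted_sums_prob_ge _ _ _ P n m Y (mean0 X beta0) Y_binary mean0_itv
  Y_mean Y_indep I (fun x => x.1.2) cI eta K K0 cIK.
apply: prob_ge_sub => // w /= QK j k.
have K_ge0 : 0 <= K by exact: ltW.
rewrite -ler_sqr ?nnegrE ?frobnorm_ge0 ?sqrtr_ge0 // [leRHS]sqr_sqrtr //.
apply: le_trans QK; rewrite sqr_frobnorm pair_bigA /=.
rewrite -(pair_bigA _ (fun jk ll => (\sum_i c jk.1 jk.2 ll.1 ll.2 i *
   (Y i jk.2 w - mean0 X beta0 i jk.2)) ^+ 2)) /=.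
rewrite (bigD1 (j, k)) //= -[leLHS]addr0; apply: lerD.
  by apply: ler_sum => -[l l'] _ /=; rewrite NE.
by apply: sumr_ge0 => *; apply: sumr_ge0 => *; exact: sqr_ge0.
Qed.

Lemma gram_form u :
  frobdot u (gram X *m u) = n%:R^-1 * \sum_i \sum_j linpred X i j u ^+ 2.
Proof.
rewrite -scalemxAl frobdotZr; congr (_ * _).
rewrite mulmx_suml frobdotC frobdot_suml; apply: eq_bigr => i _.
rewrite frobdotC -mulmxA frobdot_mulmx trmxK frobdotxx sqr_frobnorm.
by apply: eq_bigr => j _; rewrite big_ord1.
Qed.

Lemma gram_sym : (gram X)^T = gram X.
Proof.
rewrite linearZ /= linear_sum /=; congr (_ *: _); apply: eq_bigr => i _.
by rewrite trmx_mul trmxK.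
Qed.

Lemma linpred_le_row i j u :
  `|linpred X i j u| <= frobnorm (row j (X i)) * frobnorm u.
Proof.
have -> : linpred X i j u = (row j (X i) *m u) 0 0 by rewrite -row_mul mxE.
by apply: le_trans (entry_le_frobnorm _ _ _) (frobnorm_mulmx _ _).
Qed.

Lemma sqr_row_le i j z : frobnorm (row j (X i)) <= z ->
  \sum_l X i j l ^+ 2 <= z ^+ 2.
Proof.
move=> Xz; have -> : \sum_l X i j l ^+ 2 = frobnorm (row j (X i)) ^+ 2.
  by rewrite sqr_frobnorm big_ord1; apply: eq_bigr => l _; rewrite mxE.
by rewrite ler_sqr ?nnegrE ?frobnorm_ge0 // (le_trans (frobnorm_ge0 _) Xz).
Qed.

Variables (T C M b3 b4 c CR eta : R).
Hypotheses (n0 : (0 < n)%N) (p0 : (0 < p)%N) (C0 : 0 < C) (M0 : 0 < M)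
  (b30 : 0 < b3) (b40 : 0 < b4) (c0 : 0 < c) (CR0 : 0 < CR) (eta0 : 0 < eta)
  (linpred0_le : forall i j, `|linpred X i j beta0| <= T)
  (row_le : forall i j, frobnorm (row j (X i)) <= C * Num.sqrt p%:R)
  (gram_b3 : b3 <= lambda_min (gram X)) (gram_b4 : lambda_max (gram X) <= b4)
  (Rbar_pos : posdefmx Rbar)
  (Rbar_eig : forall a, eigenvalue Rbar a -> c <= a <= CR).

Let s : R := Num.sqrt (p%:R / n%:R).
Let tau : R := p%:R / Num.sqrt n%:R.

Hypothesis Rhat_close : prob_ge P (1 - eta)
  [set w | `|frobnorm (invmx (Rhat w) - invmx Rbar)| <= M * s].

Let G : R := weight_bound T.
Let K1 : R := score_const m T C eta.
Let K2 : R := deriv_const m T C eta.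
Let q : R := c^-1 + 1.
Let k0 : R := jacobian_const T b3 CR.
Let Delta : R := root_radius m T C b3 c CR eta.
Let Z : R := remainder_const m T C M b3 b4 c CR eta.

Hypotheses (tau_Z : 4 * Z * tau <= k0) (tau_rho : C * Delta * tau <= 1)
  (tau_M : M * tau <= 1).

Let G0 : 0 < G. Proof. by rewrite mulr_gt0 // expR_gt0. Qed.
Let k00 : 0 < k0. Proof. by rewrite !mulr_gt0 ?invr_gt0 ?exprn_gt0. Qed.
Let q0 : 0 < q. Proof. by rewrite addr_gt0 ?invr_gt0. Qed.
Let K10 : 0 < K1.
Proof.
by apply: ltr_wpDl => //; apply: divr_ge0; [rewrite mulr_ge0 ?sqr_ge0|exact: ltW].
Qed.
Let K20 : 0 < K2.
Proof.
by apply: ltr_wpDl => //; apply: divr_ge0; [rewrite mulr_ge0 ?sqr_ge0|exact: ltW].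
Qed.
Let Delta0 : 0 < Delta.
Proof.
apply: ltr_wpDl => //; apply: divr_ge0; last exact: ltW.
by rewrite !mulr_ge0 ?sqrtr_ge0 // ltW.
Qed.

Let nR : 0 < n%:R :> R. Proof. by rewrite ltr0n. Qed.
Let pR : 0 < p%:R :> R. Proof. by rewrite ltr0n. Qed.
Let sqn : 0 < Num.sqrt n%:R :> R. Proof. by rewrite sqrtr_gt0. Qed.
Let sqp : 0 < Num.sqrt p%:R :> R. Proof. by rewrite sqrtr_gt0. Qed.
Let s0 : 0 <= s. Proof. exact: sqrtr_ge0. Qed.
Let sE : s = Num.sqrt p%:R / Num.sqrt n%:R.
Proof. by rewrite /s sqrtrM ?ler0n // sqrtrV ?ler0n. Qed.
Let nE : n%:R = Num.sqrt n%:R ^+ 2 :> R. Proof. by rewrite sqr_sqrtr ?ler0n. Qed.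
Let pE : p%:R = Num.sqrt p%:R ^+ 2 :> R. Proof. by rewrite sqr_sqrtr ?ler0n. Qed.
Let sqp1 : 1 <= Num.sqrt p%:R :> R.
Proof.
by have := @ler_wsqrtr R 1 p%:R; rewrite sqrtr1 ler1n; apply.
Qed.
Let s_tau : s <= tau.
Proof.
have -> : tau = Num.sqrt p%:R * s by rewrite sE /tau {1}pE expr2 mulrA.
by rewrite ler_peMl.
Qed.
Let tau0 : 0 <= tau. Proof. exact: le_trans s_tau. Qed.

Lemma score_weight_le i j k : `|score_weight X beta0 i j k| <= G.
Proof.
have sd0_gt0 l : 0 < sd0 X beta0 i l by exact: sd_gt0.
have sk := sd0_lower linpred0_le i k; rewrite -/(weight_bound T) -/G in sk.
have isk : 0 < (sd0 X beta0 i k)^-1 by rewrite invr_gt0.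
rewrite normrM (gtr0_norm (sd0_gt0 j)) (gtr0_norm isk).
apply: (@le_trans _ _ (1 * G)); last by rewrite mul1r.
apply: ler_pM; [exact: ltW|exact: ltW|exact: sd_le1|].
have iG : 0 < G^-1 by rewrite invr_gt0.
by rewrite -[leRHS]invrK lef_pV2 ?posrE.
Qed.

Lemma deriv_weight1_le i j k : `|deriv_weight1 X beta0 i j k| <= G.
Proof.
rewrite normrM -[leRHS]mul1r; apply: ler_pM => //; last exact: score_weight_le.
by have /andP[? ?] := mean0_itv i j; rewrite ler_norml; apply/andP; split; lra.
Qed.

Lemma deriv_weight2_le i j k : `|deriv_weight2 X beta0 i j k| <= G.
Proof.
rewrite normrM normrN -[leRHS]mul1r; apply: ler_pM => //; last exact: score_weight_le.
by have /andP[? ?] := mean0_itv i k; rewrite ler_norml; apply/andP; split; lra.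
Qed.

Lemma score_prob_ge : prob_ge P (1 - eta)
  [set w | forall j k, frobnorm (score_term X beta0 (e w) j k)
             <= Num.sqrt (K1 * (n%:R * p%:R))].
Proof.
apply: (@frob_terms_prob_ge p 1 (fun w => score_term X beta0 (e w))
  (fun j k l _ i => score_weight X beta0 i j k * X i j l) ((G * C) ^+ 2 * p%:R)).
- by move=> w j k l l'; rewrite mxE.
- move=> i j k.
  have -> : (G * C) ^+ 2 * p%:R = G ^+ 2 * (C * Num.sqrt p%:R) ^+ 2.
    by rewrite [in LHS]pE; ring.
  under eq_bigr do rewrite big_ord1 exprMn.
  rewrite -mulr_sumr ler_pM ?sqr_ge0 ?sumr_ge0 //.
  - by move=> *; exact: sqr_ge0.
  - by rewrite -[leLHS]real_normK ?num_real // ler_sqr ?nnegrE ?score_weight_le // ltW.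
  - exact: sqr_row_le.
- by rewrite !mulr_gt0.
rewrite /K1 /score_const -/G !mulrDl mul1r mulrDr.
have -> : eta * (m%:R ^+ 2 * (G * C) ^+ 2 / eta * (n%:R * p%:R)) =
    m%:R ^+ 2 * (n%:R * ((G * C) ^+ 2 * p%:R)) by field; rewrite gt_eqF.
by rewrite lerDl !mulr_ge0 // ltW.
Qed.

(** [h] selects the component whose covariates sit in the second slot: it is
    [j] for the derivative in the first linear predictor, [k] for the other. *)
Lemma deriv_prob_ge (N : Om -> 'I_m -> 'I_m -> 'M[R]_p)
    (wt : 'I_n -> 'I_m -> 'I_m -> R) (h : 'I_m -> 'I_m -> 'I_m) :
  (forall w j k l l', N w j k l l' =
     \sum_i wt i j k * X i j l * X i (h j k) l' * e w i k) ->
  (forall i j k, `|wt i j k| <= G) ->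
  prob_ge P (1 - eta)
    [set w | forall j k, frobnorm (N w j k) <= Num.sqrt (K2 * (n%:R * p%:R ^+ 2))].
Proof.
move=> NE wtG.
apply: (@frob_terms_prob_ge p p N
  (fun j k l l' i => wt i j k * X i j l * X i (h j k) l')
  ((G * C ^+ 2) ^+ 2 * p%:R ^+ 2)) => //.
- move=> i j k.
  have -> : (G * C ^+ 2) ^+ 2 * p%:R ^+ 2 =
      G ^+ 2 * ((C * Num.sqrt p%:R) ^+ 2 * (C * Num.sqrt p%:R) ^+ 2).
    by rewrite [in LHS]pE; ring.
  under eq_bigr => l _.
    under eq_bigr => l' _ do rewrite !exprMn.
    rewrite -mulr_sumr; over.
  rewrite -mulr_suml -mulr_sumr -mulrA.
  have S0 j' : 0 <= \sum_l X i j' l ^+ 2 by apply: sumr_ge0 => *; exact: sqr_ge0.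
  apply: ler_pM; [exact: sqr_ge0|by apply: mulr_ge0; exact: S0| |].
    by rewrite -[leLHS]real_normK ?num_real // ler_sqr ?nnegrE ?wtG // ltW.
  by apply: ler_pM; rewrite ?S0 // sqr_row_le.
- by rewrite !mulr_gt0 ?exprn_gt0.
rewrite /K2 /deriv_const -/G !mulrDl mul1r mulrDr.
have -> : eta * (m%:R ^+ 2 * (G * C ^+ 2) ^+ 2 / eta * (n%:R * p%:R ^+ 2)) =
    m%:R ^+ 2 * (n%:R * ((G * C ^+ 2) ^+ 2 * p%:R ^+ 2)) by field; rewrite gt_eqF.
by rewrite lerDl !mulr_ge0 ?sqr_ge0 // ltW.
Qed.

Lemma root_radius_gt0 : 0 < Delta. Proof. exact: Delta0. Qed.
Lemma jacobian_const_gt0 : 0 < k0. Proof. exact: k00. Qed.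

(** Off four events of probability at most [eta] each, the hypotheses of
    [estfun_root] hold; in all of them the common scale is [n], and [tau_Z]
    and the choice of the radius are what remains after dividing by it. *)
Lemma root_prob_ge : prob_ge P (1 - (eta + (eta + (eta + eta))))
  [set w | exists2 b : 'cV[R]_p,
     estfun X (fun i => \col_j Y i j w) (Rhat w) b = 0 &
     frobnorm (b - beta0) <= Delta * s].
Proof.
have H1 := @deriv_prob_ge (fun w => deriv_term1 X beta0 (e w))
  (deriv_weight1 X beta0) (fun j _ => j) _ deriv_weight1_le.
have {}H1 := H1 (fun w j k l l' => mxE _ _ _ _).
have H2 := @deriv_prob_ge (fun w => deriv_term2 X beta0 (e w))
  (deriv_weight2 X beta0) (fun _ k => k) _ deriv_weight2_le.
have {}H2 := H2 (fun w j k l l' => mxE _ _ _ _).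
apply: prob_ge_sub (prob_geI Rhat_close (prob_geI score_prob_ge (prob_geI H1 H2))) => //.
move=> w /= [Rw [Sw [D1w D2w]]].
have Rw' j k : `|invmx (Rhat w) j k - invmx Rbar j k| <= M * s.
  apply: le_trans Rw; rewrite [leRHS]ger0_norm ?frobnorm_ge0 //.
  have -> : invmx (Rhat w) j k - invmx Rbar j k = (invmx (Rhat w) - invmx Rbar) j k.
    by move: (invmx _) (invmx _) => A B; rewrite !mxE.
  exact: entry_le_frobnorm.
have Ms1 : M * s <= 1.
  by apply: le_trans tau_M; rewrite ler_pM2l.
have V_le j k : `|invmx Rbar j k| <= c^-1.
  apply: entry_le_form => [|u]; first by rewrite trmx_inv Rbar_pos.1.
  have /andP[lo hi] := posdefmx_inv_form u Rbar_pos c0 Rbar_eig.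
  by rewrite hi andbT (le_trans _ lo) // mulr_ge0 ?sqr_ge0 // invr_ge0 ltW.
pose y i : 'cV[R]_m := \col_j Y i j w.
have ee : (fun i k => y i k 0 - mean0 X beta0 i k) = e w.
  by apply/funext => i; apply/funext => k; rewrite /y mxE.
have sqrtM (K x z : R) : 0 < K -> 0 <= z -> x = z ^+ 2 ->
    Num.sqrt (K * x) <= Num.sqrt K * z.
  by move=> /ltW K0 z0 ->; rewrite sqrtrM // sqrtr_sqr ger0_norm.
have muE : Num.sqrt (K2 * (n%:R * p%:R ^+ 2)) <= Num.sqrt K2 * (n%:R * tau).
  apply: sqrtM => //; first by rewrite mulr_ge0.
  by rewrite /tau exprMn expr_div_n -nE; field; rewrite gt_eqF.
have nuE : Num.sqrt (K1 * (n%:R * p%:R)) <= Num.sqrt K1 * (n%:R * s).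
  apply: sqrtM => //; first by rewrite mulr_ge0.
  by rewrite sE exprMn expr_div_n -nE -pE; field; rewrite gt_eqF.
apply: (@estfun_root R n m p X beta0 y (Rhat w) (invmx Rbar) T
  (C * Num.sqrt p%:R) (C * Delta * tau) (Delta * s) q (M * s) (b3 * n%:R)
  (b4 * n%:R) CR^-1 (Num.sqrt K2 * (n%:R * tau)) (Num.sqrt K1 * (n%:R * s))) => //.
- by move=> i k; rewrite mxE; case: (Y_binary i k w) => ->; rewrite ?lexx ?ler01.
- move=> i j u; apply: le_trans (linpred_le_row i j u) _.
  by rewrite ler_wpM2r ?frobnorm_ge0.
- by rewrite mulr_ge0 // ltW.
- rewrite sE /tau [in leRHS]pE le_eqVlt; apply/orP; left; apply/eqP; ring.
- by rewrite mulr_ge0 // ltW.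
- exact: ltW.
- move=> j k; rewrite -(subrK (invmx Rbar j k) (invmx (Rhat w) j k)).
  apply: le_trans (ler_normD _ _) _; rewrite addrC /q lerD // ?V_le //.
  exact: le_trans (Rw' j k) Ms1.
- by rewrite mulr_ge0 // ltW.
- by move=> j k; rewrite distrC.
- by rewrite mulr_gt0.
- move=> u; have := lambda_min_form u gram_sym; rewrite gram_form => low.
  have := le_trans (ler_wpM2r (sqr_ge0 (frobnorm u)) gram_b3) low.
  rewrite -(ler_pM2l nR) mulVKf ?gt_eqF //.
  by rewrite [b3 * n%:R]mulrC -mulrA.
- move=> u; have := lambda_max_form u gram_sym; rewrite gram_form => up.
  have := le_trans up (ler_wpM2r (sqr_ge0 (frobnorm u)) gram_b4).
  rewrite -(ler_pM2l nR) mulVKf ?gt_eqF //.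
  by rewrite [b4 * n%:R]mulrC -mulrA.
- by rewrite invr_gt0.
- by move=> z; have /andP[] := posdefmx_inv_form z Rbar_pos c0 Rbar_eig.
- by rewrite !mulr_ge0 ?sqrtr_ge0.
- move=> j k; rewrite ee; apply: le_trans (D1w j k) _; exact: muE.
- move=> j k; rewrite ee; apply: le_trans (D2w j k) _; exact: muE.
- move=> j k; rewrite ee; apply: le_trans (Sw j k) _; exact: nuE.
- apply: (@le_trans _ _ (n%:R * (4 * Z * tau))); last first.
    by rewrite -/(weight_bound T) -/G [leRHS]mulrA [leRHS]mulrC ler_pM2l.
  rewrite /Z /remainder_const -/Delta -/K2 -/q -subr_ge0.
  rewrite (_ : _ - _ = 4 * n%:R * M * m%:R * b4 * (tau - s)); last by ring.
  by rewrite !mulr_ge0 ?subr_ge0 // ltW.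
- rewrite -/(weight_bound T) -/G [leRHS](_ : _ = k0 * Delta * (n%:R * s)); last first.
    by rewrite /k0 /jacobian_const -/G; ring.
  rewrite [leLHS](_ : _ = 2 * (m%:R ^+ 2 * q * Num.sqrt K1) * (n%:R * s)); last by ring.
  apply: ler_wpM2r; first by rewrite mulr_ge0.
  have -> : k0 * Delta = 2 * (m%:R ^+ 2 * q * Num.sqrt K1) + k0.
    by rewrite /Delta /root_radius -/k0 -/K1 -/q; field; rewrite gt_eqF.
  by rewrite lerDl ltW.
Qed.

End FixedSample.

(** * Consistency *)

Unset Implicit Arguments.

Theorem theorem3p6 (R : realType) (m : nat) (p : nat -> nat)
  (d : nat -> measure_display) (T : forall n, measurableType (d n))
  (P : forall n, probability (T n) R)
  (X : forall n, 'I_n -> 'M[R]_(m, p n))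
  (Y : forall n, 'I_n -> 'I_m -> {RV (P n) >-> R})
  (Rhat : forall n, T n -> 'M[R]_m)
  (B : forall n, set 'cV[R]_(p n)) (beta0 : forall n, 'cV[R]_(p n))
  (R0 Rbar : nat -> 'M[R]_m)
  (p_infty : p @ \oo --> \oo)
  (Y_binary : forall n (i : 'I_n) j w, Y n i j w = 0 \/ Y n i j w = 1)
  (Y_indep : forall n, indep_vectors (P n) (fun i j => (Y n i j : T n -> R)))
  (Y_mean : forall n (i : 'I_n) j,
     ('E_(P n)[Y n i j])%E = (logit_mean (X n i) (beta0 n) j 0)%:E)
  (Y_corr : forall n (i : 'I_n) j k,
     correlation (P n) (Y n i j) (Y n i k) = R0 n j k)
  (Rhat_meas : forall n j k,
     measurable_fun [set: T n] (fun w => Rhat n w j k))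
  (A1 : (fun n => \big[Num.max/0]_(i < n) \big[Num.max/0]_(j < m)
           frobnorm (row j (X n i)))
        =O_\oo (fun n => Num.sqrt (p n)%:R : R))
  (A2_compact : forall n, compact (B n))
  (A2_interior : forall n, (B n)° (beta0 n))
  (A2_mean : exists b1 b2 : R, [/\ 0 < b1, b2 < 1 &
     \forall n \near \oo, forall (i : 'I_n) j,
       b1 <= logit_mean (X n i) (beta0 n) j 0 <= b2])
  (A3 : exists b3 b4 : R, [/\ 0 < b3, 0 < b4 &
     \forall n \near \oo,
       [/\ b3 <= lambda_min (gram (X n)),
           lambda_min (gram (X n)) <= lambda_max (gram (X n)) &
           lambda_max (gram (X n)) <= b4]])
  (A4_R0 : exists c C : R, 0 < c /\
     \forall n \near \oo, forall a, eigenvalue (R0 n) a -> c <= a <= C)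
  (A4_Rbar_posdef : forall n, posdefmx (Rbar n))
  (A4_Rbar : exists c C : R, 0 < c /\
     \forall n \near \oo, forall a, eigenvalue (Rbar n) a -> c <= a <= C)
  (A4_Rhat : bigO_prob P
     (fun n w => frobnorm (invmx (Rhat n w) - invmx (Rbar n)))
     (fun n => Num.sqrt ((p n)%:R / n%:R)))
  (p_rate : (fun n => n%:R^-1 * (p n)%:R ^+ 2 : R) =o_\oo (fun=> 1 : R)) :
  forall eps : R, 0 < eps -> exists2 Delta : R, 0 < Delta &
    \forall n \near \oo,
      prob_ge (P n) (1 - eps)
        [set w : T n | exists2 b : 'cV[R]_(p n),
           estfun (X n) (fun i => \col_j Y n i j w) (Rhat n w) b = 0 &
           frobnorm (b - beta0 n) <= Delta * Num.sqrt ((p n)%:R / n%:R)].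
Proof.
move=> eps eps0.
have [b1 [b2 [b10 b21 near_mean]]] := A2_mean.
have [b3 [b4 [b30 b40 near_gram]]] := A3.
have [c [CR [c0 near_eig]]] := A4_Rbar.
pose eta := eps / 4.
have eta0 : 0 < eta by rewrite divr_gt0.
have [M M0 near_Rhat] := A4_Rhat eta eta0.
have [C C0 near_rows] := (eqO_exP _ _ _).1 A1.
pose Tb := `|ln b1| + `|ln (1 - b2)|.
(* Positive even when the upper eigenvalue bound is vacuous, as for m = 0. *)
pose CR' := `|CR| + 1.
have CR'0 : 0 < CR' by rewrite ltr_wpDl.
pose k0 := jacobian_const Tb b3 CR'.
have k00 : 0 < k0 by exact: jacobian_const_gt0.
pose Delta := root_radius m Tb C b3 c CR' eta.
have Delta0 : 0 < Delta by exact: root_radius_gt0.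
pose Z := remainder_const m Tb C M b3 b4 c CR' eta.
(* The three smallness conditions on p / sqrt n follow from N p / sqrt n <= 1. *)
pose N := 4 * `|Z| / k0 + C * Delta + M.
have Z4 : 0 <= 4 * `|Z| / k0 by apply: divr_ge0; [rewrite mulr_ge0|exact: ltW].
have CD : 0 < C * Delta by rewrite mulr_gt0.
have N0 : 0 < N by rewrite /N; lra.
have near_p : \forall n \near \oo, (0 < p n)%N by exact: (p_infty _ (nbhs_infty_gt 0)).
have N20 : 0 < N ^- 2 by rewrite invr_gt0 exprn_gt0.
have near_rate := (eqoP _ _ _).1 p_rate _ N20.
exists Delta => //; near=> n.
have n0 : (0 < n)%N by near: n; exact: nbhs_infty_gt.
have p0 : (0 < p n)%N by near: n; exact: near_p.
have mean_n : forall (i : 'I_n) j, b1 <= logit_mean (X n i) (beta0 n) j 0 <= b2.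
  by near: n; exact: near_mean.
have gram_n : [/\ b3 <= lambda_min (gram (X n)),
    lambda_min (gram (X n)) <= lambda_max (gram (X n)) &
    lambda_max (gram (X n)) <= b4] by near: n; exact: near_gram.
have eig_n : forall a, eigenvalue (Rbar n) a -> c <= a <= CR.
  by near: n; exact: near_eig.
have Rhat_n : prob_ge (P n) (1 - eta)
    [set w | `|frobnorm (invmx (Rhat n w) - invmx (Rbar n))| <=
       M * Num.sqrt ((p n)%:R / n%:R)] by near: n; exact: near_Rhat.
have rows_n : `|\big[Num.max/0]_(i < n) \big[Num.max/0]_(j < m)
    frobnorm (row j (X n i))| <= C * `|Num.sqrt (p n)%:R : R|.
  by near: n; exact: near_rows.
have rate_n : `|n%:R^-1 * (p n)%:R ^+ 2 : R| <= N ^- 2 * `|1 : R|.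
  by near: n; exact: near_rate.
have tau_le : N * ((p n)%:R / Num.sqrt n%:R) <= 1 :> R.
  have tau0 : 0 <= (p n)%:R / Num.sqrt n%:R :> R by rewrite divr_ge0 ?sqrtr_ge0.
  have Ntau : 0 <= N * ((p n)%:R / Num.sqrt n%:R) by rewrite mulr_ge0 // ltW.
  rewrite -ler_sqr ?nnegrE //.
  rewrite expr1n exprMn expr_div_n sqr_sqrtr ?ler0n //.
  move: rate_n; rewrite normr1 mulr1 => /(le_trans (ler_norm _)).
  have N2_neq0 : N ^+ 2 != 0 by rewrite gt_eqF // exprn_gt0.
  move=> /(ler_wpM2l (sqr_ge0 N)); rewrite mulfV // [n%:R^-1 * _]mulrC.
  exact.
set tau := (p n)%:R / Num.sqrt n%:R in tau_le.
have tau0 : 0 <= tau by rewrite divr_ge0 ?sqrtr_ge0.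
have Mtau : 0 <= M * tau by rewrite mulr_ge0 // ltW.
have CDtau : 0 <= C * Delta * tau by rewrite mulr_ge0 // ltW.
have Ztau : 0 <= 4 * `|Z| / k0 * tau by rewrite mulr_ge0.
rewrite /N !mulrDl in tau_le.
have -> : eps = eta + (eta + (eta + eta)) by rewrite /eta; field.
apply: (@root_prob_ge _ _ _ _ _ _ _ (X n) (beta0 n) (Y n) (Rhat n) (Rbar n)
  (@Y_binary n) (Y_indep n) (@Y_mean n) Tb C M b3 b4 c CR' eta) => //.
- move=> i j; apply: (logit_bounded b10 b21).
  by have := mean_n i j; rewrite mxE.
- move=> i j; apply: (@le_trans _ _ (C * `|Num.sqrt (p n)%:R : R|)); last first.
    by rewrite ger0_norm ?sqrtr_ge0.
  apply: le_trans (le_trans (ler_norm _) rows_n).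
  apply: (@le_trans _ _ (\big[Num.max/0]_(j < m) frobnorm (row j (X n i)))).
    exact: (le_bigmax _ (fun j => frobnorm (row j (X n i)))).
  exact: (le_bigmax _ (fun i => \big[Num.max/0]_(j < m) frobnorm (row j (X n i)))).
- by case: gram_n.
- by case: gram_n.
- move=> a /eig_n /andP[-> aC] /=; apply: le_trans aC _.
  by have := ler_norm CR; rewrite /CR'; lra.
- have : 4 * `|Z| / k0 * tau <= 1 by lra.
  rewrite mulrAC ler_pdivrMr // mul1r; apply: le_trans.
  by rewrite ler_wpM2r // ler_wpM2l // ler_norm.
- by rewrite -/Delta -/tau; lra.
- by rewrite -/tau; lra.
Unshelve. all: by end_near. Qed.
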